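(* Let $G$ be a finitely generated group that is relatively hyperbolic with respect to a set of parabolic subgroups $\mathcal{P}$. If $\#Ends(G) > 1$ and the Bowditch boundary $\partial_{B}(G,\mathcal{P})$ is connected, then there exists $H \in \mathcal{P}$ such that $\#Ends(H) > 1$.
   Context: $Ends(H)$ is the space of ends of the group $H$. An action of $G$ by homeomorphisms on a compact Hausdorff space $Z$ has the convergence property if every wandering net (net of pairwise distinct elements) of $G$ has a subnet for which there are $a,b\in Z$ such that it converges to $a$ uniformly on compact subsets of $Z\setminus\{b\}$; its limit set is the set of such points $a$, and it is minimal if the limit set is $Z$. A point $p\in Z$ is bounded parabolic if $Stab\ p$ acts properly discontinuously and cocompactly on $Z\setminus\{p\}$. For finitely generated $G$, the action is relatively hyperbolic if it has the convergence property, its limit set has more than one point and the induced action on the space of distinct pairs of $Z$ is cocompact; it is so with respect to $\mathcal P$ if $\mathcal P$ is a set of representatives of conjugacy classes of stabilizers of bounded parabolic points. $G$ is relatively hyperbolic with respect to $\mathcal P$ if it admits such an action, and $\partial_B(G,\mathcal P)$ is the compact space carrying a minimal such action. *)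

(* Defs.v *)
From HB Require Import structures.
From mathcomp Require Import all_boot.
From mathcomp Require Import boolp classical_sets functions cardinality.
From mathcomp Require Import filter topology.

Set Implicit Arguments.
Unset Strict Implicit.
Unset Printing Implicit Defensive.

Local Open Scope classical_set_scope.
Local Open Scope group_scope.

Definition more_than_one (T : Type) (A : set T) : Prop :=
  exists x y, [/\ A x, A y & x <> y].

(** ** Subgroups and finite generation *)

Definition is_subgroup (G : groupType) (H : set G) : Prop :=
  [/\ H 1, forall x y, H x -> H y -> H (x * y) & forall x, H x -> H x^-1].

Definition generated_subgroup (G : groupType) (S : set G) : set G :=
  smallest (@is_subgroup G) S.

Definition finitely_generated (G : groupType) : Prop :=
  exists2 S : set G, finite_set S & generated_subgroup S = [set: G].

Definition conjugate_subgroup (G : groupType) (g : G) (H : set G) : set G :=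
  [set g * h * g^-1 | h in H].

(** ** Ends *)

(* The space of ends of an arbitrary (discrete) group H, in the sense of
   Freudenthal, Hopf and Specker: it is the remainder of the Freudenthal
   compactification of H, that is, the set of ultrafilters, on the Boolean
   algebra of almost invariant subsets of H, that contain no finite set.
   No generating set of H is involved; if H is generated by a finite set S, the
   almost invariant subsets are those with finite coboundary in the Cayley
   graph of (H, S), and one recovers the ends of that graph; see
   [more_than_one_ends_cayleyP] below.  Here H is a subgroup of an ambient
   group G, and the definition only depends on H. *)
Definition almost_invariant (G : groupType) (H A : set G) : Prop :=
  A `<=` H /\ forall h, H h -> finite_set (A `+` [set x * h | x in A]).

Definition is_end (G : groupType) (H : set G) (E : set (set G)) : Prop :=
  [/\ E `<=` almost_invariant H,
      forall A B, E A -> E B -> E (A `&` B),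
      forall A B, E A -> almost_invariant H B -> A `<=` B -> E B,
      forall A, almost_invariant H A -> E A \/ E (H `\` A)
    & forall A, E A -> infinite_set A].

Definition Ends (G : groupType) (H : set G) : set (set (set G)) :=
  [set E | is_end H E].

(* The connected component of x in the Cayley graph of S (with edges joining y
   to y * s for s in S) deprived of the vertices in F. *)
Definition cayley_component (G : groupType) (S F : set G) (x : G) : set G :=
  smallest (fun C : set G => forall y s, S s ->
    (C y -> ~ F (y * s) -> C (y * s)) /\ (C (y * s) -> ~ F y -> C y)) [set x].

Section CayleyGraph.
Variables (G : groupType) (S : set G).
Hypothesis finS : finite_set S.
Let H := generated_subgroup S.
Implicit Types (A B C F : set G) (x y z g h s : G).

Let generated_subgroupP : is_subgroup H.
Proof.
split=> [M [[M1 _ _] _]//|x y Hx Hy M [Mg SM]|x Hx M [Mg SM]].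
  by case: (Mg) => _ MM _; apply: MM; [apply: Hx|apply: Hy].
by case: (Mg) => _ _ MV; apply: MV; apply: Hx.
Qed.

Let H1 : H 1. Proof. by case: generated_subgroupP. Qed.
Let HM x y : H x -> H y -> H (x * y).
Proof. by case: generated_subgroupP => _ + _; apply. Qed.
Let HV x : H x -> H x^-1. Proof. by case: generated_subgroupP => _ _; apply. Qed.
Let SH : S `<=` H. Proof. by move=> s Ss M [_]; apply. Qed.

Let generated_ind (M : set G) : is_subgroup M -> S `<=` M -> H `<=` M.
Proof. by move=> Mg SM x; apply. Qed.

Let translateE A h : [set x * h | x in A] = [set x | A (x * h^-1)].
Proof.
apply/seteqP; split=> [_ [x Ax <-]|x Ax] /=; first by rewrite mulgK.
by exists (x * h^-1) => //; rewrite mulgVK.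
Qed.

Let finite_translate A h : finite_set A -> finite_set [set x | A (x * h)].
Proof.
move=> fA; rewrite (_ : mkset _ = [set x * h^-1 | x in A]).
  exact: finite_image.
by rewrite translateE invgK.
Qed.

Let almost_invariant_gen A : A `<=` H ->
  (forall s, S s -> finite_set (A `+` [set x * s | x in A])) ->
  almost_invariant H A.
Proof.
move=> AH fA; split=> //; apply: generated_ind => //; split=> [|g h fg fh|g fg].
- by rewrite translateE invg1 (_ : A `+` _ = set0) //; apply/seteqP;
    split=> // x []/= []; rewrite mulg1.
- apply: (@sub_finite_set _ _
    ((A `+` [set x * h | x in A]) `|`
     [set x | (A `+` [set x * g | x in A]) (x * h^-1)])).
    move=> x; rewrite !translateE /= invgM mulgA.
    by have [] := pselect (A (x * h^-1)); tauto.
  by rewrite finite_setU; split=> //; apply: finite_translate.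
- apply: (@sub_finite_set _ _ [set x | (A `+` [set x * g | x in A]) (x * g)]).
    by move=> x; rewrite !translateE /= invgK mulgK; tauto.
  exact: finite_translate.
Qed.

Let comp_closed F x y s : S s ->
  (cayley_component S F x y -> ~ F (y * s) -> cayley_component S F x (y * s)) /\
  (cayley_component S F x (y * s) -> ~ F y -> cayley_component S F x y).
Proof.
move=> Ss; split=> Cy nF M [MC xM].
- by apply: (MC _ _ Ss).1 => //; apply: Cy.
- by apply: (MC _ _ Ss).2 => //; apply: Cy.
Qed.

Let comp_refl F x : cayley_component S F x x.
Proof. by move=> M [_]; apply. Qed.

Let comp_ind F x C : C x ->
  (forall y s, S s -> (C y -> ~ F (y * s) -> C (y * s)) /\
    (C (y * s) -> ~ F y -> C y)) -> cayley_component S F x `<=` C.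
Proof. by move=> Cx CC y; apply; split=> // _ ->. Qed.

Let comp_avoid F x : ~ F x -> cayley_component S F x `<=` ~` F.
Proof. by move=> nFx; apply: comp_ind. Qed.

Let comp_sub F x : H x -> cayley_component S F x `<=` H.
Proof.
move=> Hx; apply: comp_ind => // y s /SH Hs; split=> [Hy _|Hys _].
  exact: HM.
by rewrite -(mulgK s y); apply: HM => //; apply: HV.
Qed.

Let comp_subset F x y : cayley_component S F y x ->
  cayley_component S F x `<=` cayley_component S F y.
Proof. by move=> Cx; apply: comp_ind => // z s; apply: comp_closed. Qed.

Let comp_disj F x y : ~ F x -> ~ cayley_component S F y x ->
  cayley_component S F x `<=` ~` cayley_component S F y.
Proof.
move=> nFx nC; suff: cayley_component S F x `<=`
    ~` F `&` ~` cayley_component S F y by move=> + z Cz => /(_ z Cz)[].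
apply: comp_ind => // z s Ss; split=> -[nF1 nC1] nF2; split=> // Cz; apply: nC1.
  exact: (comp_closed _ _ _ Ss).2 Cz _.
exact: (comp_closed _ _ _ Ss).1 Cz _.
Qed.

Let comp_sym F x y : ~ F x -> cayley_component S F x y ->
  cayley_component S F y x.
Proof.
move=> nFx Cy; apply: contrapT => nC.
exact: (comp_disj nFx nC Cy (@comp_refl F y)).
Qed.

Let comp_almost_invariant F x : finite_set F -> H x -> ~ F x ->
  almost_invariant H (cayley_component S F x).
Proof.
move=> fF Hx nFx; apply: almost_invariant_gen; first exact: comp_sub.
move=> s Ss; apply: (@sub_finite_set _ _ (F `|` [set z | F (z * s^-1)])).
  move=> z; rewrite translateE => -[] /= [Cz nCz]; apply: contrapT => /not_orP[].
  - move=> _ nF; apply: nCz; apply: (comp_closed _ _ _ Ss).2 => //.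
    by rewrite mulgVK.
  - move=> nF _; apply: nCz; rewrite -(mulgVK s z).
    by apply: (comp_closed _ _ _ Ss).1 => //; rewrite mulgVK.
by rewrite finite_setU; split=> //; apply: finite_translate.
Qed.

Let end_of_component C : almost_invariant H C -> infinite_set C ->
  exists2 E, Ends H E & E C.
Proof.
move=> aC iC; pose W : set_system G := [set A | finite_set (C `\` A)].
have WP : ProperFilter W.
  split; first by rewrite /W /= setD0.
  split=> [|A B fA fB|A B AB fA]; first by rewrite /W /= setDT.
  - by rewrite /W /= setDIr finite_setU.
  - by apply: sub_finite_set fA; apply: setDS.
have [U [UU WU]] := ultraFilterLemma WP.
have nU A : finite_set A -> ~ U A.
  move=> fA UA; apply: (@filter_not_empty _ U).
  rewrite -(setICr A); apply: filterI => //; apply: WU.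
  by apply: sub_finite_set fA => x [_ /contrapT].
have UC : U C by apply: WU; rewrite /W /= setDv.
exists [set A | almost_invariant H A /\ U A]; last by split.
split=> /=.
- by move=> A [].
- move=> A B [[AH aA] UA] [[BH aB] UB]; split; last exact: filterI.
  split=> [x [/AH]//|h Hh].
  apply: (@sub_finite_set _ _ ((A `+` [set x * h | x in A]) `|`
                               (B `+` [set x * h | x in B]))).
    move=> x; rewrite !translateE /=; have [] := pselect (A (x * h^-1)).
      by have [] := pselect (A x); tauto.
    by tauto.
  by rewrite finite_setU; split; [apply: aA|apply: aB].
- by move=> A B [_ UA] aB AB; split=> //; apply: filterS UA.
- move=> A aA; have [UA|UA] := in_ultra_setVsetC A UU; [by left|right].
  split; last by apply: filterS (filterI UC UA) => x [/(aC.1)].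
  case: aA => AH aA; split=> [x []//|h Hh]; apply: sub_finite_set (aA h Hh) => x.
  rewrite !translateE /=.
  have Hxh : H (x * h^-1) <-> H x.
    by split=> Hx; [rewrite -(mulgVK h x)|]; apply: HM => //; apply: HV.
  by have [] := pselect (A x); have [] := pselect (A (x * h^-1)); tauto.
- by move=> A [_ UA] /nU.
Qed.

Let infinite_component F B : finite_set F -> B `<=` H -> infinite_set B ->
  H `\` B !=set0 ->
  (forall y s, S s -> H y -> ~ F y -> ~ F (y * s) -> B y <-> B (y * s)) ->
  exists z, [/\ B z, ~ F z, infinite_set (cayley_component S F z) &
    cayley_component S F z `<=` B].
Proof.
move=> fF BH iB [w [Hw nBw]] stB.
have compB z : B z -> ~ F z -> cayley_component S F z `<=` B.
  move=> Bz nFz; suff: cayley_component S F z `<=` B `&` ~` F.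
    by move=> + y Cy => /(_ y Cy)[].
  apply: comp_ind => // y s Ss; split=> -[By nFy] nF; split=> //.
    exact: (stB y s Ss (BH _ By) nFy nF).1 By.
  have Hy : H y by rewrite -(mulgK s y); apply: HM; [apply: BH|apply: HV; apply: SH].
  exact: (stB y s Ss Hy nF nFy).2 By.
pose N := \bigcup_(s in S) ([set z | F (z * s)] `|` [set z | F (z * s^-1)]).
have fN : finite_set N.
  by apply: bigcup_finite => // s Ss; rewrite finite_setU;
    split; apply: finite_translate.
have meetN z : B z -> ~ F z -> exists2 y, N y & cayley_component S F z y.
  move=> Bz nFz; apply: contrapT => nN.
  have NC y : cayley_component S F z y -> ~ N y.
    by move=> Cy Ny; apply: nN; exists y.
  pose M : set G := [set h | forall y, cayley_component S F z y ->
    cayley_component S F z (y * h) /\ cayley_component S F z (y * h^-1)].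
  have HsubM : H `<=` M.
    apply: generated_ind.
      split=> [y|g h Mg Mh y Cy|g Mg y Cy]; rewrite ?invg1 ?mulg1 //.
        rewrite invgM !mulgA.
        by split; [apply: (Mh _ (Mg _ Cy).1).1|apply: (Mg _ (Mh _ Cy).2).2].
      by rewrite invgK; have [] := Mg _ Cy.
    move=> s Ss y Cy; have nNy := NC _ Cy; split.
      by apply: (comp_closed _ _ _ Ss).1 => // Fy; apply: nNy; exists s => //; left.
    apply: (comp_closed _ _ _ Ss).2; first by rewrite mulgVK.
    by move=> Fy; apply: nNy; exists s => //; right.
  apply: nBw; apply: (compB z Bz nFz).
  rewrite -(mulVKg z w).
  have /HsubM /(_ z (@comp_refl F z))[] // : H (z^-1 * w).
  by apply: HM => //; apply: HV; apply: BH.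
apply: contrapT => nz; apply: iB.
apply: (@sub_finite_set _ _ (F `|`
  \bigcup_(y in N `&` (B `&` ~` F)) cayley_component S F y)).
  move=> z Bz; have [Fz|nFz] := pselect (F z); [by left|right].
  have [y Ny Cy] := meetN _ Bz nFz.
  exists y; last exact: comp_sym.
  by split=> //; split; [apply: (compB z)|apply: comp_avoid Cy].
rewrite finite_setU; split=> //; apply: bigcup_finite.
  by apply: sub_finite_set fN => ? [].
move=> y [_ [By nFy]]; apply: contrapT => iC; apply: nz.
by exists y; split=> //; apply: compB.
Qed.

Lemma more_than_one_ends_cayleyP : more_than_one (Ends H) <->
  exists F x y, [/\ finite_set F, (H `\` F) x, (H `\` F) y &
    [/\ infinite_set (cayley_component S F x),
        infinite_set (cayley_component S F y) &
        cayley_component S F x <> cayley_component S F y]].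
Proof.
split; last first.
  move=> [F [x [y [fF [Hx nFx] [Hy nFy] [ix iy nxy]]]]].
  have [E EE Ex] := end_of_component (comp_almost_invariant fF Hx nFx) ix.
  have [E' EE' Ey] := end_of_component (comp_almost_invariant fF Hy nFy) iy.
  exists E, E'; split=> // EE'E; rewrite -{}EE'E in Ey.
  case: EE => _ EI _ _ Einf; apply: (Einf _ (EI _ _ Ex Ey)).
  rewrite (_ : _ `&` _ = set0) //; apply/seteqP; split=> // z [Cx Cy].
  have Cyx : cayley_component S F y x.
    by apply: contrapT => nC; apply: comp_disj nFx nC z Cx Cy.
  by apply: nxy; apply/seteqP; split; apply: comp_subset => //; apply: comp_sym.
move=> [E [E' [EE EE' nE]]].
have [A [aA iA iB]] : exists A, [/\ almost_invariant H A,
    infinite_set A & infinite_set (H `\` A)].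
  have main D D' : is_end H D -> is_end H D' -> ~ (D `<=` D') ->
      exists A, [/\ almost_invariant H A,
        infinite_set A & infinite_set (H `\` A)].
    move=> [Dai _ _ _ Dinf] [_ _ _ D'o D'inf] /existsNP[A /not_implyP[DA nD'A]].
    exists A; split; [exact: Dai|exact: Dinf|apply: D'inf].
    by case: (D'o A (Dai _ DA)).
  have [EsE'|nEE'] := pselect (E `<=` E'); last exact: main nEE'.
  by apply: main EE' EE _ => E'E; apply: nE; apply/seteqP.
case: aA => AH aA.
pose D s := A `+` [set x * s | x in A].
pose F := \bigcup_(s in S) (D s `|` [set x | D s (x * s)]).
have fF : finite_set F.
  apply: bigcup_finite => // s Ss; rewrite finite_setU.
  by split; [|apply: finite_translate]; apply: aA; apply: SH.
have st y s : S s -> ~ F y -> A y <-> A (y * s).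
  move=> Ss nF; apply: contrapT => nst; apply: nF; exists s => //; right.
  rewrite /D translateE /= mulgK.
  by have [] := pselect (A y); have [] := pselect (A (y * s)); tauto.
have AcH : H `\` A `<=` H by move=> ? [].
have [x [Ax nFx ix xA]] : exists z, [/\ A z, ~ F z,
    infinite_set (cayley_component S F z) & cayley_component S F z `<=` A].
  apply: infinite_component => //; last by move=> y s Ss _ nF _; apply: st.
  by apply/set0P/eqP => B0; apply: iB; rewrite B0.
have [y [[Hy nAy] nFy iy yA]] : exists z, [/\ (H `\` A) z, ~ F z,
    infinite_set (cayley_component S F z) &
    cayley_component S F z `<=` H `\` A].
  apply: infinite_component => //.
    have /set0P[z Az] : A != set0 by apply/eqP => A0; apply: iA; rewrite A0.
    by exists z; split; [apply: AH|case].
  move=> y s Ss Hy nF _; have stA := st y s Ss nF.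
  by split=> -[_ nA]; split; [apply: HM => //; apply: SH|tauto|
    |tauto].
exists F, x, y; split=> //; first by split=> //; apply: AH.
split=> // CC; apply: nAy; apply: xA; rewrite CC; exact: comp_refl.
Qed.

End CayleyGraph.

(** ** Nets *)

Record net (T : Type) := Net {
  net_index : Type;
  net_le : net_index -> net_index -> Prop;
  net_inhabited : inhabited net_index;
  net_refl : forall i, net_le i i;
  net_trans : forall i j k, net_le i j -> net_le j k -> net_le i k;
  net_directed : forall i j, exists k, net_le i k /\ net_le j k;
  net_val :> net_index -> T }.

(* An index set with a greatest element must be excluded: otherwise every
   one-term net would be wandering. *)
Definition wandering (T : Type) (s : net T) : Prop :=
  (forall i j, s i = s j -> i = j) /\
  (forall i, exists j, ~ @net_le T s j i).

Definition subnet (T : Type) (t s : net T) : Prop :=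
  exists phi : net_index t -> net_index s,
    (forall j, t j = s (phi j)) /\
    (forall i, exists j0, forall j,
      @net_le T t j0 j -> @net_le T s i (phi j)).

(** ** Convergence actions *)

Record topological_action (G : groupType) (Z : topologicalType) := {
  act :> G -> Z -> Z;
  act1 : forall z, act 1 z = z;
  actM : forall g h z, act (g * h) z = act g (act h z);
  act_continuous : forall g, continuous (act g) }.

(* Uniform convergence to the constant map a on the compact subsets of
   Z \ {b}: in a compact Hausdorff space, the neighborhoods of a are exactly the
   sections at a of the entourages of the unique uniform structure. *)
Definition collapses_to (G : groupType) (Z : topologicalType)
    (phi : topological_action G Z) (s : net G) (a b : Z) : Prop :=
  forall K : set Z, compact K -> K `<=` ~` [set b] ->
  forall U : set Z, nbhs a U ->
  exists i0, forall i, @net_le G s i0 i -> phi (s i) @` K `<=` U.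

Definition convergence_property (G : groupType) (Z : topologicalType)
    (phi : topological_action G Z) : Prop :=
  forall s : net G, wandering s ->
  exists t a b, subnet t s /\ collapses_to phi t a b.

Definition limit_set (G : groupType) (Z : topologicalType)
    (phi : topological_action G Z) : set Z :=
  [set a | exists s t b,
    [/\ wandering s, subnet t s & collapses_to phi t a b]].

Definition minimal_action (G : groupType) (Z : topologicalType)
    (phi : topological_action G Z) : Prop :=
  limit_set phi = [set: Z].

Definition stabilizer (G : groupType) (Z : topologicalType)
    (phi : topological_action G Z) (p : Z) : set G :=
  [set g | phi g p = p].

(* The space Z \ {p} is locally compact, so that its quotient is compact iff
   Z \ {p} is covered by the translates of a compact subset. *)
Definition bounded_parabolic (G : groupType) (Z : topologicalType)
    (phi : topological_action G Z) (p : Z) : Prop :=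
  (forall K : set Z, compact K -> K `<=` ~` [set p] ->
     finite_set [set g | stabilizer phi p g /\ (phi g @` K) `&` K !=set0]) /\
  (exists K : set Z, [/\ compact K, K `<=` ~` [set p] &
     forall z, z <> p -> exists2 g, stabilizer phi p g & K (phi g z)]).

Definition cocompact_on_pairs (G : groupType) (Z : topologicalType)
    (phi : topological_action G Z) : Prop :=
  exists K : set (Z * Z), [/\ compact K, K `<=` [set z | z.1 <> z.2] &
    forall x y, x <> y -> exists g, K (phi g x, phi g y)].

Definition relatively_hyperbolic_action (G : groupType) (Z : topologicalType)
    (phi : topological_action G Z) : Prop :=
  [/\ convergence_property phi, more_than_one (limit_set phi) &
      cocompact_on_pairs phi].

Definition parabolic_representatives (G : groupType) (Z : topologicalType)
    (phi : topological_action G Z) (P : set (set G)) : Prop :=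
  (forall H, P H -> exists2 p, bounded_parabolic phi p & H = stabilizer phi p)
  /\ (forall p, bounded_parabolic phi p ->
        exists! H, P H /\ exists g, conjugate_subgroup g H = stabilizer phi p).

Definition relatively_hyperbolic_action_wrt (G : groupType)
    (Z : topologicalType) (phi : topological_action G Z)
    (P : set (set G)) : Prop :=
  relatively_hyperbolic_action phi /\ parabolic_representatives phi P.

Definition relatively_hyperbolic (G : groupType) (P : set (set G)) : Prop :=
  exists (Z : topologicalType) (phi : topological_action G Z),
    [/\ hausdorff_space Z, compact [set: Z] &
        relatively_hyperbolic_action_wrt phi P].

Definition is_bowditch_boundary (G : groupType) (P : set (set G))
    (Z : topologicalType) : Prop :=
  [/\ hausdorff_space Z, compact [set: Z] &
    exists2 phi : topological_action G Z,
      relatively_hyperbolic_action_wrt phi P & minimal_action phi].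

(* Main.v *)
(* Let A be an almost invariant set of G, infinite and with infinite complement.
   Its accumulation points in Z and those of its complement are nonempty closed
   sets that cover Z by minimality, so, Z being connected, they share a point x.
   By cocompactness on pairs, the edges (g, g s) of the Cayley graph get
   exponentially small, as seen in Z, when g goes to infinity along a geodesic
   issued from 1; so a translate g A not containing 1 is close to g when g is far.
   It follows that x is not conical, hence is bounded parabolic, and that both A
   and its complement meet the stabilizer of x in an infinite set, so that this
   stabilizer has more than one end.

   Limits are taken along ultrafilters on arbitrary index types. The
   compactification of G by Z is never built: elements of G are located in Z
   through their action on a triple of base points. *)

Require Import Defs.
From mathcomp Require Import all_boot.
From mathcomp Require Import boolp classical_sets functions cardinality.
From mathcomp Require Import filter topology.

Set Implicit Arguments.
Unset Strict Implicit.
Unset Printing Implicit Defensive.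

Local Open Scope classical_set_scope.
Local Open Scope group_scope.

(** * Ultrafilters *)

Section Ultrafilters.
Context {I : Type} (F : set_system I) {FU : UltraFilter F}.
Implicit Types A B : set I.

Lemma ultraC A : ~ F A -> F (~` A).
Proof. by have [] := in_ultra_setVsetC A FU. Qed.

Lemma ultra_meets A : (forall B, F B -> exists2 i, B i & A i) -> F A.
Proof. by move=> h; apply: contrapT => /ultraC /h[i]. Qed.

Lemma ultra_contradiction A : F A -> F (~` A) -> False.
Proof.
by move=> FA FnA; have [i []] := filter_ex (filterI FA FnA).
Qed.

Lemma ultra_finite_fiber (T : eqType) (f : I -> T) (D : set T) :
  finite_set D -> F [set i | D (f i)] ->
  exists2 d, D d & F [set i | f i = d].
Proof.
move=> /finite_seqP[s ->{D}]; elim: s => [|x s IH].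
  by move=> /filter_ex[i].
move=> Fs; have [Fx|/ultraC Fnx] := pselect (F [set i | f i = x]).
  by exists x => //=; rewrite mem_head.
have [|d ds Fd] := IH.
  apply: filterS (filterI Fs Fnx) => i [/=]; rewrite inE.
  by move=> /orP[/eqP|].
by exists d => //=; rewrite inE; apply/orP; right.
Qed.

Lemma ultra_finite_or (J : eqType) (D : set J) (Q : J -> set I) :
  finite_set D -> F [set i | exists2 j, D j & Q j i] ->
  exists2 j, D j & F (Q j).
Proof.
move=> /finite_seqP[s ->{D}]; elim: s => [|x s IH].
  by move=> /filter_ex[i []].
move=> Fs; have [Fx|/ultraC Fnx] := pselect (F (Q x)).
  by exists x => //=; rewrite mem_head.
have [|d ds Fd] := IH.
  apply: filterS (filterI Fs Fnx) => i [[j /=]]; rewrite inE.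
  by move=> /orP[/eqP->|js Qj _]; last exists j.
by exists d => //=; rewrite inE; apply/orP; right.
Qed.

End Ultrafilters.

Lemma nonprincipal_ultrafilter (T : Type) (A : set T) : infinite_set A ->
  exists F : set_system T,
    [/\ UltraFilter F, F A & forall B, finite_set B -> ~ F B].
Proof.
move=> iA; pose W : set_system T := [set B | finite_set (A `\` B)].
have WP : ProperFilter W.
  split; first by rewrite /W /= setD0.
  split=> [|B C fB fC|B C BC fB]; first by rewrite /W /= setDT.
  - by rewrite /W /= setDIr finite_setU.
  - by apply: sub_finite_set fB; apply: setDS.
have [U [UU WU]] := ultraFilterLemma WP.
exists U; split=> //; first by apply: WU; rewrite /W /= setDv.
move=> B fB UB; apply: (ultra_contradiction UB); apply: WU.
by apply: sub_finite_set fB => x [_ /contrapT].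
Qed.

Lemma infinite_set_injection (T : Type) (A : set T) : infinite_set A ->
  exists2 f : nat -> T, injective f & forall n, A (f n).
Proof.
move=> /infiniteP/card_leP[f].
pose u (n : nat) : [set: nat] := SigSub (mem_set (Logic.I : [set: nat] n)).
exists (fun n => set_val (f (u n))) => [m n /val_inj E|n]; last exact: set_valP.
by have /(congr1 val) := 'inj_f (mem_set Logic.I) (mem_set Logic.I) E.
Qed.

Lemma fun_cvgP (T : topologicalType) (I : Type) (F : set_system I)
    (f : I -> T) (x : T) :
  f @ F --> x <-> forall U : set T, nbhs x U -> F [set i | U (f i)].
Proof. by []. Qed.

Lemma ultra_cvg (T : topologicalType) (I : Type) (F : set_system I)
    (FU : UltraFilter F) (f : I -> T) :
  compact [set: T] ->
  exists x : T, f @ F --> x.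
Proof.
move=> cT; have [x [_ clx]] := cT (fmap f F) _ filterT.
exists x; apply/fun_cvgP => U xU; apply: ultra_meets => B FB.
have [|_ [[i Bi <-] Ui]] := clx (f @` B) U _ xU; last by exists i.
by rewrite /fmap /=; apply: filterS FB => i Bi; exists i.
Qed.

Lemma ultra_cvg_unique (T : topologicalType) (I : Type) (F : set_system I)
    (FU : UltraFilter F) (f : I -> T) (x y : T) :
  hausdorff_space T -> f @ F --> x -> f @ F --> y -> x = y.
Proof. by move=> hT; apply: (@cvg_unique T hT (fmap f F) _). Qed.

Lemma hausdorff_pair (T U : topologicalType) :
  hausdorff_space T -> hausdorff_space U -> hausdorff_space (T * U)%type.
Proof.
move=> hT hU [x y] [x' y'] cl; congr pair.
  apply: hT => A B xA x'B.
  have [||[u v] [[Au _] [Bu _]]] := cl (A `*` setT) (B `*` setT).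
  - by exists (A, setT) => //; split=> //; apply: filterT.
  - by exists (B, setT) => //; split=> //; apply: filterT.
  - by exists u.
apply: hU => A B yA y'B.
have [||[u v] [[_ Av] [_ Bv]]] := cl (setT `*` A) (setT `*` B).
- by exists (setT, A) => //; split=> //; apply: filterT.
- by exists (setT, B) => //; split=> //; apply: filterT.
- by exists v.
Qed.
(** * Collapsing families *)

Section Collapse.
Context {G : groupType} {Z : topologicalType} (phi : topological_action G Z).
Hypotheses (hZ : hausdorff_space Z) (cZ : compact [set: Z]).

Definition squeezes (U V : set Z) : set G :=
  [set g | forall z, ~ V z -> U (phi g z)].

(* On a compact Hausdorff space the compact subsets of Z \ {b} are cofinal with
   the complements of the neighborhoods of b, so this is uniform convergence to
   a on compact subsets of Z \ {b}; the formulation makes passing to inverses,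
   which exchanges a and b, immediate. *)
Definition collapses {I : Type} (F : set_system I) (g : I -> G) (a b : Z) :=
  forall U V : set Z, nbhs a U -> nbhs b V -> F [set i | squeezes U V (g i)].

(** Going to infinity in the discrete group [G]; along an ultrafilter the only alternative is to be
    constant. *)
Definition escapes {I : Type} (F : set_system I) (g : I -> G) :=
  forall D : set G, finite_set D -> ~ F [set i | D (g i)].

Lemma actK g : cancel (phi g) (phi g^-1).
Proof. by move=> z; rewrite -actM mulVg act1. Qed.

Lemma actVK g : cancel (phi g^-1) (phi g).
Proof. by move=> z; rewrite -actM mulgV act1. Qed.

Lemma act_inj g : injective (phi g).
Proof. exact: can_inj (actK g). Qed.

Lemma nbhs_act g z U : nbhs (phi g z) U -> nbhs z [set x | U (phi g x)].
Proof. exact: act_continuous. Qed.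

Lemma separation (a b : Z) : a <> b ->
  exists U V, [/\ nbhs a U, nbhs b V & forall z, U z -> V z -> False].
Proof.
move=> nab; apply: contrapT => h; apply: nab; apply: hZ => U V aU bV.
apply: contrapT => UV; apply: h; exists U, V; split=> // z Uz Vz.
by apply: UV; exists z.
Qed.

Lemma squeezesS U V U' V' : U `<=` U' -> V `<=` V' ->
  squeezes U V `<=` squeezes U' V'.
Proof. by move=> UU VV g gUV z nV; apply: UU; apply: gUV => /VV. Qed.

Lemma squeezesV U V g : squeezes U V g -> squeezes V U g^-1.
Proof.
move=> gUV z nUz; apply: contrapT => /gUV; rewrite actVK; exact: nUz.
Qed.

Section Ultra.
Context {I : Type} (F : set_system I) {FU : UltraFilter F}.
Implicit Types (g k : I -> G) (a b z : Z) (h : G).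

Lemma escapesP g : (forall x, ~ F [set i | g i = x]) -> escapes F g.
Proof.
by move=> nF D fD /(ultra_finite_fiber fD)[d _]; apply: nF.
Qed.

Lemma constant_or_escapes g : (exists x, F [set i | g i = x]) \/ escapes F g.
Proof.
have [|n] := pselect (exists x, F [set i | g i = x]); first by left.
by right; apply: escapesP => x Fx; apply: n; exists x.
Qed.

Lemma escapes_mulr g h : escapes F g -> escapes F (fun i => g i * h).
Proof.
move=> eg D fD FD; apply: (eg [set x * h^-1 | x in D]).
  exact: finite_image.
by apply: filterS FD => i Di; exists (g i * h) => //; rewrite mulgK.
Qed.

Lemma escapesV g : escapes F g -> escapes F (fun i => (g i)^-1).
Proof.
move=> eg D fD FD; apply: (eg [set x^-1 | x in D]).
  exact: finite_image.
by apply: filterS FD => i Di; exists (g i)^-1 => //; rewrite invgK.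
Qed.

Lemma collapses_cvg g (f : I -> Z) a b z : collapses F g a b ->
  f @ F --> z -> z <> b -> (fun i => phi (g i) (f i)) @ F --> a.
Proof.
move=> gab /fun_cvgP fz nzb; apply/fun_cvgP => U aU.
have [W [V [zW bV WV]]] := separation nzb.
by apply: filterS (filterI (gab _ _ aU bV) (fz _ zW)) => i [gUV Wi];
  apply: gUV => /(WV _ Wi).
Qed.

Lemma collapses_cvg_cst g a b z : collapses F g a b ->
  z <> b -> (fun i => phi (g i) z) @ F --> a.
Proof.
by move=> gab; apply: (@collapses_cvg g (fun=> z) _ _ z gab); apply: cvg_cst.
Qed.

Lemma collapsesV g a b : collapses F g a b ->
  collapses F (fun i => (g i)^-1) b a.
Proof.
by move=> gab U V bU aV; apply: filterS (gab _ _ aV bU) => i; apply: squeezesV.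
Qed.

Lemma collapses_mull g h a b : collapses F g a b ->
  collapses F (fun i => h * g i) (phi h a) b.
Proof.
move=> gab U V haU bV.
apply: filterS (gab _ _ (nbhs_act haU) bV) => i gUV z nVz.
by rewrite actM; apply: gUV.
Qed.

Lemma collapses_mulr g h a b : collapses F g a b ->
  collapses F (fun i => g i * h) a (phi h^-1 b).
Proof.
move=> gab U V aU bV; apply: filterS (gab _ _ aU (nbhs_act bV)) => i gUV z nVz.
by rewrite actM; apply: gUV; rewrite /= actK.
Qed.

End Ultra.
Arguments collapses_mull {I F FU g} h {a b}.
Arguments collapses_mulr {I F FU g} h {a b}.

Lemma ultra_near_eq_cvg {I : Type} (F : set_system I) {FU : UltraFilter F}
    (f f' : I -> Z) (x : Z) :
  F [set i | f i = f' i] -> f @ F --> x -> f' @ F --> x.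
Proof.
move=> E /fun_cvgP fx; apply/fun_cvgP => U xU.
by apply: filterS (filterI E (fx _ xU)) => i [/= <-].
Qed.

(** * From the convergence property to collapsing ultrafilters *)

Section ConvergenceProperty.
Hypothesis cvP : convergence_property phi.

Lemma compact_setC_interior (V : set Z) : compact (~` V°).
Proof.
apply: subclosed_compact cZ _ => //; apply: open_closedC; exact: open_interior.
Qed.

(** An injective sequence in [A] is a wandering net, and one term far along a collapsing subnet
    suffices. The complement of [V] need not be compact, that of its interior is. *)
Lemma infinite_squeezes (A : set G) : infinite_set A ->
  exists a b : Z, forall U V : set Z, nbhs a U -> nbhs b V ->
    exists2 g, A g & squeezes U V g.
Proof.
move=> /infinite_set_injection[f finj fA].
pose s : net G := Net (inhabits 0%N) leqnn
  (fun i j k ij jk => leq_trans ij jk)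
  (fun i j => ex_intro _ (maxn i j) (conj (leq_maxl i j) (leq_maxr i j))) f.
have ws : wandering s.
  split=> [i j /finj//|i]; exists i.+1 => /=; by rewrite ltnn.
have [t [a [b [[u [tu _]] tab]]]] := cvP ws.
exists a, b => U V aU bV.
have [|i0 ti0] := tab _ (@compact_setC_interior V) _ _ aU.
  move=> z nVz /= zb; apply: nVz; rewrite zb.
  exact: nbhs_singleton (nbhs_interior bV).
exists (t i0); first by rewrite tu; apply: fA.
move=> z nVz; apply: (ti0 i0 (net_refl i0)); exists z => //.
by move=> /interior_subset.
Qed.

(* A wandering net is injective, so an ultrafilter cannot be fed directly to the
   convergence property. Instead, every J in F contains an injective sequence,
   hence has a nonempty set L J of pairs (a, b) to which members of J come
   arbitrarily close to collapsing; compactness of Z * Z gives a pair that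
   adheres to all the L J. *)
Lemma ultra_collapses {I : Type} (F : set_system I) {FU : UltraFilter F}
    (g : I -> G) : escapes F g -> exists a b, collapses F g a b.
Proof.
move=> eg.
pose L (J : set I) : set (Z * Z) := [set ab | forall U V : set Z,
  nbhs ab.1 U -> nbhs ab.2 V -> exists2 i, J i & squeezes U V (g i)].
pose W : set_system (Z * Z) := [set P | exists2 J, F J & L J `<=` P].
have LN0 J : F J -> L J !=set0.
  move=> FJ; have [|a [b ab]] := @infinite_squeezes [set g i | i in J].
    by move=> fJ; apply: (eg _ fJ); apply: filterS FJ => i Ji; exists i.
  by exists (a, b) => U V aU bV; have [_ [i Ji <-]] := ab _ _ aU bV; exists i.
have WP : ProperFilter W.
  split; first by move=> [J /LN0[x Jx] /(_ x Jx)].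
  split=> [|P Q [J FJ JP] [K FK KQ]|P Q PQ [J FJ JP]].
  - by exists setT; first exact: filterT.
  - exists (J `&` K); first exact: filterI.
    move=> ab JK; split; [apply: JP|apply: KQ] => U V aU bV;
      by have [i [Ji Ki]] := JK _ _ aU bV; exists i.
  - by exists J => // ab /JP/PQ.
have [] := compact_setX cZ cZ (F := W).
  by exists setT => //; apply: filterT.
move=> [a b] [_ clab]; exists a, b => U V aU bV; apply: ultra_meets => J FJ.
have [||[a' b'] [/= LJ [aU' bV']]] := clab (L J) (U° `*` V°).
- by exists J.
- by exists (U°, V°) => //; split; apply: nbhs_interior.
exact: LJ.
Qed.

End ConvergenceProperty.

(** * Accumulation points of subsets of [G] in a connected space *)

Section Connected.
Hypotheses (coZ : connected [set: Z]) (twoZ : more_than_one [set: Z]).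

Lemma not_isolated (y : Z) (V : set Z) : nbhs y V -> exists2 z, V z & z <> y.
Proof.
move=> yV; apply: contrapT => iso.
have Vy : V `<=` [set y].
  by move=> z Vz; apply: contrapT => zy; apply: iso; exists z.
have [x [x' [_ _ xx']]] := twoZ.
have yT : [set y] = [set: Z].
  apply: coZ; first by exists y.
  - exists [set y]; last by rewrite setTI.
    by rewrite openE => _ ->; apply: filterS Vy yV.
  - exists [set y]; last by rewrite setTI.
    exact: accessible_closed_set1 (hausdorff_accessible hZ) y.
apply: xx'; have yE z : z = y by have : [set: Z] z by []; rewrite -yT.
by rewrite (yE x) (yE x').
Qed.

Lemma avoid_two (b b' : Z) : exists z, z <> b /\ z <> b'.
Proof.
have [<-|bb'] := pselect (b = b').
  by have [z _ zb] := @not_isolated b setT filterT; exists z.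
have [U [V [bU bV UV]]] := separation bb'.
have [z Uz zb] := not_isolated bU; exists z; split=> // zb'.
by apply: (UV z) => //; rewrite zb'; apply: nbhs_singleton.
Qed.

(** A point away from both repelling points is carried to both attracting points. *)
Lemma collapses_uniq {I : Type} (F : set_system I) {FU : UltraFilter F}
    (g : I -> G) (a b a' b' : Z) :
  collapses F g a b -> collapses F g a' b' -> a = a'.
Proof.
move=> gab gab'; have [z [zb zb']] := avoid_two b b'.
exact: (ultra_cvg_unique FU hZ (collapses_cvg_cst gab zb)
  (collapses_cvg_cst gab' zb')).
Qed.

(* z is an accumulation point of A in the compactification of G by Z. *)
Definition clusters_at (A : set G) (z : Z) : Prop :=
  exists b : Z, forall U V : set Z, nbhs z U -> nbhs b V ->
    infinite_set (A `&` squeezes U V).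

Lemma clusters_atP A z : clusters_at A z -> exists (F : set_system G) (b : Z),
  [/\ UltraFilter F, F A, escapes F id & collapses F id z b].
Proof.
move=> [b Ab].
pose W : set_system G := [set X | exists U V : set Z, [/\ nbhs z U, nbhs b V
  & finite_set ((A `&` squeezes U V) `\` X)]].
have WP : ProperFilter W.
  split; first by move=> [U [V [zU bV]]]; rewrite setD0; apply: Ab.
  split=> [|X Y [U [V [zU bV UVX]]] [U' [V' [zU' bV' UVY]]]|X Y XY].
  - by exists setT, setT; split; try exact: filterT; rewrite setDT.
  - exists (U `&` U'), (V `&` V'); split; try exact: filterI.
    rewrite setDIr finite_setU; split; [apply: sub_finite_set UVX|
      apply: sub_finite_set UVY]; apply: setSD; apply: setIS;
      by apply: squeezesS => ? [].
  - move=> [U [V [zU bV UVX]]]; exists U, V; split=> //.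
    by apply: sub_finite_set UVX; apply: setDS.
have [F [FU WF]] := ultraFilterLemma WP; exists F, b; split=> //.
- apply: WF; exists setT, setT; split; try exact: filterT.
  by rewrite (_ : _ `\` A = set0) // -subset0 => g [[]].
- move=> D fD FD; apply: (ultra_contradiction FD); apply: WF.
  exists setT, setT; split; try exact: filterT.
  by apply: sub_finite_set fD => g [_ /contrapT].
- move=> U V zU bV; apply: WF; exists U, V; split=> //.
  by rewrite (_ : _ `\` _ = set0) // -subset0 => g [[]].
Qed.

Lemma clusters_at_ultra {I : Type} (F : set_system I) {FU : UltraFilter F}
    (g : I -> G) (A : set G) (z b : Z) :
  F [set i | A (g i)] -> escapes F g -> collapses F g z b -> clusters_at A z.
Proof.
move=> FA eg gzb; exists b => U V zU bV fin; apply: (eg _ fin).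
exact: filterI FA (gzb _ _ zU bV).
Qed.

Lemma clusters_at_ex (A : set G) : convergence_property phi ->
  infinite_set A -> exists z, clusters_at A z.
Proof.
move=> cvP /nonprincipal_ultrafilter[F [FU FA nF]].
have eF : escapes F id by move=> D fD; apply: nF.
have [a [b ab]] := ultra_collapses cvP eF.
by exists a; apply: (clusters_at_ultra FA eF ab).
Qed.

(** The repelling point varies with the accumulation point; compactness of [Z] supplies one that
    serves in the limit. *)
Lemma closed_clusters_at A : closed [set z | clusters_at A z].
Proof.
move=> z clz.
pose W : set_system Z := [set P | exists2 U : set Z, nbhs z U &
  [set b | forall V : set Z, nbhs b V -> infinite_set (A `&` squeezes U V)]
    `<=` P].
have WP : ProperFilter W.
  split=> [[U zU Ub]|].
    have [z' [[b z'b] Uz']] := clz _ (nbhs_interior zU).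
    by apply: (Ub b) => V; apply: z'b.
  split=> [|P Q [U zU UP] [U' zU' UQ]|P Q PQ [U zU UP]].
  - by exists setT => //; apply: filterT.
  - exists (U `&` U'); first exact: filterI.
    move=> b UUb; split; [apply: UP|apply: UQ] => V bV fin; apply: (UUb _ bV);
      apply: sub_finite_set fin; apply: setIS; by apply: squeezesS => // ? [].
  - by exists U => //; apply: subset_trans PQ.
have [b [_ clb]] := cZ WP filterT.
exists b => U V zU bV.
have [|b' [Ub' Vb']] := clb [set b | forall V : set Z, nbhs b V ->
  infinite_set (A `&` squeezes U V)] _ _ (nbhs_interior bV).
  by exists U.
exact: Ub'.
Qed.

(** If finitely many elements squeezed, injectivity would bound their indices by some [k]; but some
    index is not below [k], and the subnet ends up beyond that index. *)
Lemma limit_set_clusters_at z : limit_set phi z -> clusters_at setT z.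
Proof.
move=> [s [t [b [[sinj ws] [u [tu ut]] tzb]]]]; exists b => U V zU bV.
rewrite setTI => /finite_seqP[l sl].
have [k kP] : exists k, forall i, s i \in l -> net_le i k.
  elim: l {sl} => [|x l [k IH]].
    by have [i0] := net_inhabited s; exists i0.
  have [[i0 i0x]|nx] := pselect (exists i, s i = x); last first.
    exists k => i; rewrite inE => /orP[/eqP ix|/IH//].
    by exfalso; apply: nx; exists i.
  have [m [km im]] := net_directed k i0; exists m => i.
  rewrite inE => /orP[/eqP ix|/IH ik]; last exact: net_trans km.
  by rewrite (sinj i i0) // i0x.
have [j njk] := ws k; have [j0 uj0] := ut j.
have [|i0 ti0] := tzb _ (@compact_setC_interior V) _ _ zU.
  move=> x nVx /= xb; apply: nVx; rewrite xb.
  exact: nbhs_singleton (nbhs_interior bV).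
have [m [j0m i0m]] := net_directed j0 i0.
apply: njk; apply: net_trans (uj0 _ j0m) _; apply: kP; rewrite -tu.
have : squeezes U V (t m).
  move=> x nVx; apply: (ti0 _ i0m); exists x => //.
  by move=> /interior_subset.
by rewrite sl.
Qed.

Lemma clusters_at_setU A B z :
  clusters_at (A `|` B) z -> clusters_at A z \/ clusters_at B z.
Proof.
move=> /clusters_atP[F [b [FU FAB eF zb]]].
have [FA|/ultraC FnA] := pselect (F A).
  by left; apply: (clusters_at_ultra FA eF zb).
right; apply: (clusters_at_ultra _ eF zb).
by apply: filterS (filterI FAB FnA) => g [[]].
Qed.

Lemma common_cluster_point (A : set G) : convergence_property phi ->
  minimal_action phi -> infinite_set A -> infinite_set (~` A) ->
  exists z, clusters_at A z /\ clusters_at (~` A) z.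
Proof.
move=> cvP minP iA inA; apply: contrapT => disj.
pose cl B : set Z := [set z | clusters_at B z].
have [z Az] := clusters_at_ex cvP iA.
have [z' nAz'] := clusters_at_ex cvP inA.
have clE : cl A = ~` cl (~` A).
  apply/seteqP; split=> x; first by move=> Ax nAx; apply: disj; exists x.
  move=> nx; have : clusters_at (A `|` ~` A) x.
    by rewrite setUv; apply: limit_set_clusters_at; rewrite minP.
  by move=> /clusters_at_setU[].
have clT : cl A = [set: Z].
  apply: coZ; first by exists z.
  - exists (cl A); last by rewrite setTI.
    by rewrite clE; apply: closed_openC; apply: closed_clusters_at.
  - exists (cl A); last by rewrite setTI.
    exact: closed_clusters_at.
by apply: disj; exists z'; split=> //; have : [set: Z] z' by []; rewrite -clT.
Qed.

(** * Closeness of group elements and geodesics *)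

Section SmallSets.
(* K, K1 and D are increasing neighborhoods of the compact set given by
   cocompactness on pairs; a pair outside D is thought of as close. *)
Variables (K K1 D : set (Z * Z)).
Hypotheses (closedK : closed K) (closedK1 : closed K1).
Hypothesis KK1 : forall p, K p -> nbhs p K1.
Hypothesis K1D : forall p, K1 p -> nbhs p D.
Hypothesis D_diag :
  forall z : Z, exists2 C, nbhs z C & forall x y, C x -> C y -> ~ D (x, y).
Hypothesis K_cover : forall x y, x <> y -> exists g, K (phi g x, phi g y).

Definition small (C : set Z) := forall x y, C x -> C y -> ~ D (x, y).

Lemma K1_neq (x : Z) : ~ K1 (x, x).
Proof.
have [C xC sC] := D_diag x; move=> /K1D/nbhs_singleton.
by apply: sC; apply: nbhs_singleton.
Qed.

Lemma K_neq (x : Z) : ~ K (x, x).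
Proof. by move=> /KK1/nbhs_singleton/K1_neq. Qed.

(** [option bool] serves as a type with three elements. *)
Variable o : option bool -> Z.
Hypotheses (o_inj : injective o) (Ko : forall i j, i <> j -> K (o i, o j)).

Lemma base_avoid (b : Z) : exists i j, [/\ i <> j, o i <> b & o j <> b].
Proof.
have [b0|] := pselect (o None = b).
  exists (Some true), (Some false).
  by split=> // /esym; rewrite -b0 => /o_inj.
have [b1|] := pselect (o (Some true) = b); last by exists None, (Some true).
exists None, (Some false).
by split=> // /esym; rewrite -b1 => /o_inj.
Qed.

(* An element g of G stands for the triple of the g (o i), of which all but at
   most one get close to the limit when g goes to infinity. As any two majorities
   of a triple meet, "two of the three points" behaves like a single point. *)
Definition near_set (g : G) (C : set Z) :=
  exists i j, [/\ i <> j, C (phi g (o i)) & C (phi g (o j))].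

Definition close (g g' : G) :=
  exists C, [/\ small C, near_set g C & near_set g' C].

(** No small set contains two base points, so 1 is not even close to itself. This is what makes
    close families escape. *)
Lemma close1 g : ~ close 1 g.
Proof.
move=> [C [sC [i [j [ij]]]]]; rewrite !act1 => Ci Cj _.
by apply: (sC _ _ Ci Cj); apply: nbhs_singleton; apply: K1D;
  apply: nbhs_singleton; apply: KK1; apply: Ko.
Qed.

Lemma close_sym g g' : close g g' -> close g' g.
Proof. by move=> [C [sC ng ng']]; exists C. Qed.

Section UltraClose.
Context {I : Type} (F : set_system I) {FU : UltraFilter F}.
Implicit Types (g k : I -> G) (a b z : Z) (h : G).

Lemma collapses_base g a b (U : set Z) : collapses F g a b -> nbhs a U ->
  F [set i | forall j, o j <> b -> U (phi (g i) (o j))].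
Proof.
move=> gab aU.
have Fj j : F [set i | o j <> b -> U (phi (g i) (o j))].
  have [jb|jb] := pselect (o j = b).
    by apply: filterS filterT => i _ /(_ jb).
  have /fun_cvgP/(_ _ aU) : (fun i => phi (g i) (o j)) @ F --> a.
    exact: collapses_cvg_cst gab jb.
  by move=> FjU; apply: filterS FjU => i Ui _.
apply: filterS (filterI (Fj None) (filterI (Fj (Some true)) (Fj (Some false)))).
by move=> i [F0 [F1 F2]] [[]|].
Qed.

Lemma collapses_near_set g a b (U : set Z) : collapses F g a b -> nbhs a U ->
  F [set i | near_set (g i) U].
Proof.
move=> gab aU; have [j [l [jl jb lb]]] := base_avoid b.
by apply: filterS (collapses_base gab aU) => i Ui; exists j, l; split=> //;
  apply: Ui.
Qed.

Lemma near_set_meets g a b (U : set Z) : collapses F g a b -> nbhs a U ->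
  F [set i | forall C, near_set (g i) C -> exists2 x, C x & U x].
Proof.
move=> gab aU; apply: filterS (collapses_base gab aU) => i Ui C.
move=> [j [l [jl Cj Cl]]].
have [jb|jb] := pselect (o j = b); last first.
  by exists (phi (g i) (o j)) => //; apply: Ui.
exists (phi (g i) (o l)) => //; apply: Ui => lb; apply: jl; apply: o_inj.
by rewrite jb lb.
Qed.

Lemma collapses_close g k a b b' : collapses F g a b -> collapses F k a b' ->
  F [set i | close (g i) (k i)].
Proof.
move=> gab kab; have [C aC sC] := D_diag a.
apply: filterS (filterI (collapses_near_set gab aC) (collapses_near_set kab aC)).
by move=> i [gC kC]; exists C.
Qed.

Hypothesis cvP : convergence_property phi.

Lemma close_escapes g k : (forall h, F [set i | close (h * g i) (h * k i)]) ->
  escapes F g.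
Proof.
move=> gk; apply: escapesP => x Fx.
have [i [/= <-]] := filter_ex (filterI Fx (gk x^-1)).
by rewrite mulVg => /close1.
Qed.

(** Were the two limits distinct, some [h] would move them to a pair of [K]; all pairs near that one
    lie in [D], so no small set comes near both translated limits. *)
Lemma close_collapses g k :
  (forall h, F [set i | close (h * g i) (h * k i)]) ->
  exists a b b', collapses F g a b /\ collapses F k a b'.
Proof.
move=> gk.
have [a [b gab]] := ultra_collapses cvP (close_escapes gk).
have kg h : F [set i | close (h * k i) (h * g i)].
  by apply: filterS (gk h) => i; apply: close_sym.
have [a' [b' kab]] := ultra_collapses cvP (close_escapes kg).
suff aa' : a = a' by exists a, b, b'; rewrite {2}aa'.
apply: contrapT => /K_cover[h /KK1/nbhs_singleton/K1D[[U U'] /= [aU aU'] UUD]].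
have hg : collapses F (fun i => h * g i) (phi h a) b by apply: collapses_mull.
have hk : collapses F (fun i => h * k i) (phi h a') b' by apply: collapses_mull.
have gU := near_set_meets hg aU; have kU := near_set_meets hk aU'.
have [i [[gUi kUi] [C [sC /gUi[x Cx Ux] /kUi[y Cy Uy]]]]] :=
  filter_ex (filterI (filterI gU kU) (gk h)).
by apply: (sC x y) => //; apply: (UUD (x, y)).
Qed.

End UltraClose.

Hypothesis cvP : convergence_property phi.

(* A compactness argument: if g, g' and g', g'' remain close under all of G, then
   g, g' and g'' have the same limit. *)
Lemma close_contraction : exists2 S : set G, finite_set S &
  forall g g' g'', (forall h, S h -> close (h * g) (h * g')) ->
    (forall h, S h -> close (h * g') (h * g'')) -> close g g''.
Proof.
apply: contrapT => nS.
(* Counterexamples to the contraction for [S]. An ultrafilter containing every [M S] with [S] finite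
   satisfies both closeness hypotheses for all [h] at once. *)
pose M (S : set G) : set (G * G * G) := [set t |
  [/\ forall h, S h -> close (h * t.1.1) (h * t.1.2),
      forall h, S h -> close (h * t.1.2) (h * t.2) & ~ close t.1.1 t.2]].
have MS S S' : S `<=` S' -> M S' `<=` M S.
  by move=> SS t [gg gg' ng]; split=> // h /SS; [apply: gg|apply: gg'].
pose W : set_system (G * G * G) :=
  [set X | exists2 S, finite_set S & M S `<=` X].
have WP : ProperFilter W.
  split=> [[S fS MS0]|].
    apply: nS; exists S => // g g' g'' gg gg'; apply: contrapT => ng.
    by apply: (MS0 (g, g', g'')).
  split=> [|X Y [S fS SX] [S' fS' SY]|X Y XY [S fS SX]].
  - by exists set0 => //; apply: finite_set0.
  - exists (S `|` S'); first by rewrite finite_setU.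
    by move=> t Mt; split; [apply: SX|apply: SY]; apply: MS Mt => ? ?;
      [left|right].
  - by exists S => // t /SX/XY.
have [F [FU WF]] := ultraFilterLemma WP.
have FM h : F (M [set h]) by apply: WF; exists [set h] => //; apply: finite_set1.
have F1 h : F [set t | close (h * t.1.1) (h * t.1.2)].
  by apply: filterS (FM h) => t [gg _ _]; apply: gg.
have F2 h : F [set t | close (h * t.1.2) (h * t.2)].
  by apply: filterS (FM h) => t [_ gg _]; apply: gg.
have [a [b [b' [gab kab]]]] := close_collapses cvP F1.
have [a' [c [c' [kac lac]]]] := close_collapses cvP F2.
have aa' := collapses_uniq kab kac; rewrite -aa' in lac.
apply: (ultra_contradiction (collapses_close gab lac)).
by apply: filterS (FM 1) => t [].
Qed.

(** * Word length, and the smallness of edges far from 1 *)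

Section Geodesics.
Variable S : set G.
Hypotheses (finS : finite_set S) (S1 : S 1) (SV : forall s, S s -> S s^-1).
Hypothesis S_contr : forall g g' g'',
  (forall h, S h -> close (h * g) (h * g')) ->
  (forall h, S h -> close (h * g') (h * g'')) -> close g g''.

Fixpoint ball n : set G :=
  if n is m.+1 then [set g | exists2 s, S s & ball m (s^-1 * g)] else [set 1].

Hypothesis S_gen : forall g, exists n, ball n g.

Lemma ball_mull n g s : ball n g -> S s -> ball n.+1 (s * g).
Proof. by move=> ng Ss; exists s => //; rewrite mulKg. Qed.

Lemma ball_mulr n g s : ball n g -> S s -> ball n.+1 (g * s).
Proof.
elim: n g => [_ ->|n IH g [t St ng]] Ss.
  by exists s => //; rewrite mul1g mulVg.
by exists t => //; rewrite mulgA; apply: IH.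
Qed.

Lemma ball_mul m n g h : ball m g -> ball n h -> ball (m + n) (g * h).
Proof.
elim: m g => [|m IH] g; first by move=> ->; rewrite mul1g.
by move=> [s Ss mg] nh; exists s => //; rewrite mulgA; apply: IH.
Qed.

Lemma ballV n g : ball n g -> ball n g^-1.
Proof.
elim: n g => [_ ->|n IH g [t St /IH ng]]; first by rewrite /= invg1.
have := ball_mulr ng (SV St); by rewrite -invgM mulVKg.
Qed.

Lemma ball_mono m n g : (m <= n)%N -> ball m g -> ball n g.
Proof.
move=> /subnKC <-; elim: (n - m)%N => [|k IH]; first by rewrite addn0.
by move=> /IH mg; rewrite addnS; exists 1 => //; rewrite invg1 mul1g.
Qed.

Lemma finite_ball n : finite_set (ball n).
Proof.
elim: n => [|n IH]; first exact: finite_set1.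
apply: (@sub_finite_set _ _ (\bigcup_(s in S) [set s * g | g in ball n])).
  by move=> g [s Ss sg]; exists s => //; exists (s^-1 * g) => //; rewrite mulVKg.
by apply: bigcup_finite => // s _; apply: finite_image.
Qed.

Lemma finite_sub_ball (B : set G) : finite_set B -> exists n, B `<=` ball n.
Proof.
move=> /finite_seqP[l ->]; elim: l => [|x l [n IH]]; first by exists 0%N.
have [m mx] := S_gen x; exists (maxn m n) => g /=; rewrite inE.
by move=> /orP[/eqP->|/IH]; [apply: ball_mono mx; apply: leq_maxl|
  apply: ball_mono; apply: leq_maxr].
Qed.

(** To be thought of as a visual distance of order 2^-n; [nclose_trans], which loses one level, is
    then the weak triangle inequality of Frink's metrization lemma. *)
Fixpoint nclose n (g g' : G) : Prop :=
  if n is m.+1 then forall s, S s -> nclose m (s * g) (s * g') else close g g'.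

Lemma nclose_trans n g g' g'' :
  nclose n.+1 g g' -> nclose n.+1 g' g'' -> nclose n g g''.
Proof.
elim: n g g' g'' => [|n IH] g g' g''; first exact: S_contr.
by move=> gg gg' s Ss; apply: (IH _ (s * g')); [apply: gg|apply: gg'].
Qed.

Lemma nclose_ball n g g' h : nclose n g g' -> ball n h ->
  close (h * g) (h * g').
Proof.
elim: n g g' h => [|n IH] g g' h; first by move=> gg ->; rewrite !mul1g.
move=> gg /ballV[s Ss /ballV]; rewrite invgM !invgK => nh.
have := IH _ _ _ (gg _ (SV Ss)) nh.
by rewrite -!mulgA !mulVKg.
Qed.

(** When [g] goes to infinity with [s] fixed, [g] and [g * s] have the same limit; as [S] is finite,
    only finitely many [g] start an edge that is not close. *)
Lemma close_edge : exists n, forall g s, ~ ball n g -> S s -> close g (g * s).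
Proof.
pose B := [set g | exists2 s, S s & ~ close g (g * s)].
have [fB|iB] := pselect (finite_set B).
  have [n nB] := finite_sub_ball fB; exists n => g s ng Ss.
  by apply: contrapT => ngs; apply/ng/nB; exists s.
have [F [FU FB nF]] := nonprincipal_ultrafilter iB.
have [s _ Fs] := @ultra_finite_or _ F FU _ S
  (fun s => [set g | ~ close g (g * s)]) finS FB.
have eF : escapes F id by move=> E fE; apply: nF.
have [a [b ab]] := ultra_collapses cvP eF.
by case: (ultra_contradiction (collapses_close ab (collapses_mulr s ab)) Fs).
Qed.

(** Each translation by a generator brings [g] nearer to 1 by at most one unit. *)
Lemma nclose_edge R : (forall g s, ~ ball R g -> S s -> close g (g * s)) ->
  forall n g s, ~ ball (R + n) g -> S s -> nclose n g (g * s).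
Proof.
move=> RP; elim=> [|n IH] g s; first by rewrite addn0; apply: RP.
move=> ng Ss t St; rewrite mulgA; apply: IH => //.
move=> tg; apply: ng; rewrite addnS.
by rewrite -(mulKg t g); apply: ball_mull => //; apply: SV.
Qed.

(* The edge from p to p * s is n.+1-close and, inductively, so are p * s and h;
   [nclose_trans] then loses one level, which the step outward has gained. *)
Lemma nclose_outward R : (forall g s, ~ ball R g -> S s -> close g (g * s)) ->
  forall j p h i n, ball j (p^-1 * h) -> ~ ball (i + j) h ->
    (R + n < i)%N -> nclose n p h.
Proof.
move=> RP; elim=> [|j IH] p h i n.
  move=> ph; have {ph} <- : p = h by rewrite -(mulVKg p h) ph mulg1.
  rewrite addn0 => ip Ri; rewrite -[X in nclose _ _ X]mulg1.
  by apply: (nclose_edge RP) => // /ball_mono np; apply: ip; apply/np/ltnW.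
move=> jh ih Ri; have [s Ss] := jh; rewrite mulgA -invgM => psh.
apply: (@nclose_trans _ _ (p * s)); last first.
  by apply: (IH _ _ i.+1); rewrite ?addSn ?addnS in ih *.
apply: (nclose_edge RP) => // np; apply: ih; rewrite -(mulVKg p h).
by apply: ball_mul => //; apply: ball_mono np; rewrite addnS.
Qed.

(** Walk along a word from [p] to [h] and stop at the first edge that enters [X]. *)
Lemma geodesic_crossing (X : set G) m p h : ball m (p^-1 * h) -> ~ X p -> X h ->
  exists i j q s, [/\ (i + j)%N = m, ball i (p^-1 * q) & ball j (q^-1 * h)] /\
    [/\ ~ X q, S s & X (q * s)].
Proof.
elim: m p => [|m IH] p.
  move=> ph nXp Xh; case: nXp.
  by have <- : h = p by rewrite -(mulVKg p h) ph mulg1.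
move=> ph nXp Xh; have [s Ss] := ph; rewrite mulgA -invgM => psh.
have [Xps|nXps] := pselect (X (p * s)).
  by exists 0%N, m.+1, p, s; rewrite add0n /= mulVg.
have [i [j [q [t [[ij iq jq] [nXq St Xqt]]]]]] := IH _ psh nXps Xh.
exists i.+1, j, q, t; rewrite addSn ij; do !split=> //.
by exists s => //; rewrite mulgA -invgM.
Qed.

Lemma nclose_crossing R : (forall g s, ~ ball R g -> S s -> close g (g * s)) ->
  forall (X : set G) h, ~ X 1 -> X h -> exists q s,
    [/\ ~ X q, S s, X (q * s) & forall n, ~ ball (R + n).+2 q -> nclose n q h].
Proof.
move=> RP X h nX1 Xh.
have [m0 mh0] := S_gen h; have exm : exists m, `[< ball m h >].
  by exists m0; apply/asboolP.
case: (ex_minnP exm) => m /asboolP mh minm.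
have [|i [j [q [s [[ij iq jq] [nXq Ss Xqs]]]]]] :=
    @geodesic_crossing X m 1 h _ nX1 Xh.
  by rewrite invg1 mul1g.
exists q, s; split=> // n nq; rewrite invg1 mul1g in iq.
have [iR|] := leqP i (R + n).+2; first by case: nq; apply: ball_mono iR iq.
(* By minimality [h] is at distance exactly [i.+1 + j] from 1, hence outside the ball of radius
   [i + j], as [nclose_outward] requires. *)
case: i ij iq => [//|i] ij iq; rewrite ltnS => iR.
apply: (@nclose_outward _ RP j q h i) => //; last exact: ltnW.
by move=> /asboolP/minm; rewrite -ij addSn ltnn.
Qed.

(** Only edges entering [A] are counted; those leaving it enter the complement. Almost invariance in
    [G] is this property for both sets. *)
Definition boundary_finite (A : set G) :=
  forall s, finite_set [set x | ~ A x /\ A (x * s)].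

Lemma collapses_inside_gen (A : set G) {I : Type} (F : set_system I)
    {FU : UltraFilter F} (g k : I -> G) (a b : Z) :
  boundary_finite A -> escapes F g -> collapses F g a b ->
  F [set i | A (k i)] -> F [set i | ~ A (g i)^-1] ->
  exists c, collapses F (fun i => g i * k i) a c.
Proof.
move=> bA eg gab Ak nAg; have [R RP] := close_edge.
pose B := \bigcup_(s in S) [set x | ~ A x /\ A (x * s)].
have fB : finite_set B by apply: bigcup_finite => // s _; apply: bA.
have FB : F [set i | exists2 d, B d &
    forall n, ~ ball (R + n).+2 (g i * d) -> nclose n (g i * d) (g i * k i)].
  apply: filterS (filterI Ak nAg) => i [/= Aki nAgi].
  have [||q [s [nAq Ss Aqs qn]]] :=
      nclose_crossing RP (X := [set x | A ((g i)^-1 * x)]) (h := g i * k i).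
  - by rewrite /= mulg1.
  - by rewrite /= mulKg.
  - exists ((g i)^-1 * q); last by rewrite mulVKg.
    by exists s => //; split=> //; rewrite -mulgA.
(* The crossing vertex is [g i * d] with [d] in a finite set, so one [d] serves for almost all [i];
   right multiplication by it keeps the attracting point. *)
have [d _ Fd] := ultra_finite_or fB FB.
have egd : escapes F (fun i => g i * d) by apply: escapes_mulr.
have cl h : F [set i | close (h * (g i * d)) (h * (g i * k i))].
  have [n nh] := S_gen h.
  have Fn : F [set i | ~ ball (R + n).+2 (g i * d)].
    by apply: ultraC; apply: egd; apply: finite_ball.
  apply: filterS (filterI Fd Fn) => i [/= di /di nd].
  exact: nclose_ball nd nh.
have [a' [b' [c [gda' gkc]]]] := close_collapses cvP cl.
have gda : collapses F (fun i => g i * d) a (phi d^-1 b).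
  exact: collapses_mulr.
by exists c; rewrite (collapses_uniq gda gda').
Qed.

End Geodesics.

Hypothesis fgG : finitely_generated G.

(* The heart of the argument: if a geodesic from 1 to [g i * k i] enters
   [g i A] it does so through the translate by [g i] of the finite boundary of
   [A], and thereafter runs away from 1, along edges that get exponentially
   small; so its endpoint has the same limit as [g i]. *)
Lemma collapses_inside (A : set G) {I : Type} (F : set_system I)
    {FU : UltraFilter F} (g k : I -> G) (a b : Z) :
  boundary_finite A -> escapes F g -> collapses F g a b ->
  F [set i | A (k i)] -> F [set i | ~ A (g i)^-1] ->
  exists c, collapses F (fun i => g i * k i) a c.
Proof.
have [S0 fS0 S0P] := close_contraction.
have [S1 fS1 S1gen] := fgG.
(* A single symmetric finite set containing 1 that both generates [G] and contracts. *)
pose T := S0 `|` S1; pose S := T `|` [set s^-1 | s in T] `|` [set 1].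
have fT : finite_set T by rewrite finite_setU.
have fS : finite_set S.
  by rewrite !finite_setU; split; [split=> //; apply: finite_image|apply: finite_set1].
have oneS : S 1 by right.
have SV s : S s -> S s^-1.
  move=> [[Ts|[t Tt <-]]|->]; last by rewrite invg1.
    by left; right; exists s.
  by rewrite invgK; left; left.
apply: (collapses_inside_gen (S := S)) => // [g' g'' g''' gg gg'|x].
  by apply: (S0P g' g'') => h S0h; [apply: gg|apply: gg']; left; left; left.
have xgen : generated_subgroup S1 x by rewrite S1gen.
apply: (xgen [set y | exists n, ball S n y]); split=> [|s S1s].
  split; first by exists 0%N.
    by move=> y z [m my] [n nz]; exists (m + n)%N; apply: ball_mul.
  by move=> y [m my]; exists m; apply: ballV.
exists 1%N; exists s; [by left; left; right|by rewrite /= mulVg].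
Qed.

(** * Nonconical points are bounded parabolic *)

(** A point is conical when some family sends all other points to [a] and the point itself to a
    limit other than [a]. *)
Definition nonconical (p : Z) : Prop :=
  forall (I : Type) (F : set_system I) (g : I -> G) (a b : Z), UltraFilter F ->
    escapes F g -> collapses F g a b -> (fun i => phi (g i) p) @ F --> a.

(** If [c] differs from [a], choose [k i] in [A] so near to [x] that [g i * k i] remains near [c];
    [collapses_inside] sends it to [a] instead. *)
Lemma clusters_limit (A : set G) (x : Z) {I : Type} (F : set_system I)
    {FU : UltraFilter F} (g : I -> G) (a c : Z) :
  boundary_finite A -> clusters_at A x -> escapes F g -> collapses F g a x ->
  F [set i | ~ A (g i)^-1] -> (fun i => phi (g i) x) @ F --> c -> c = a.
Proof.
move=> bA /clusters_atP[E [y [EU EA _ xy]]] eg gax nAg /fun_cvgP gxc.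
apply: contrapT => /separation[U [V [cU aV UV]]].
have /choice[k kP] i :
    exists k, U° (phi (g i) x) -> A k /\ near_set (g i * k) U.
  have [gU|] := pselect (U° (phi (g i) x)); last by exists 1.
  have gxy : collapses E (fun k => g i * k) (phi (g i) x) y.
    exact: (collapses_mull (g i) xy).
  by have [k Ak] := filter_ex (filterI EA (collapses_near_set gxy gU)); exists k.
have FU' := gxc _ (nbhs_interior cU).
have Ak : F [set i | A (k i)] by apply: filterS FU' => i /kP[].
have [d gka] := collapses_inside bA eg gax Ak nAg.
have [i [/kP[_ nU] /(_ _ nU)[z Uz Vz]]] :=
  filter_ex (filterI FU' (near_set_meets gka aV)).
exact: UV Uz Vz.
Qed.

Lemma clusters_nonconical (A : set G) (x : Z) :
  boundary_finite A -> boundary_finite (~` A) ->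
  clusters_at A x -> clusters_at (~` A) x -> nonconical x.
Proof.
move=> bA bnA Ax nAx I F g a b FU eg gab.
have [xb|xb] := pselect (x = b); last exact: collapses_cvg_cst gab xb.
rewrite -{}xb in gab.
have [c gc] := ultra_cvg FU (fun i => phi (g i) x) cZ.
suff <- : c = a by [].
(* The inverses of the [g i] almost all avoid [A] or almost all avoid its complement;
   [clusters_limit] is applied to the avoided set. *)
have [Fg|/ultraC Fg] := pselect (F [set i | A (g i)^-1]).
  apply: (clusters_limit bnA nAx eg gab) => //.
  by apply: filterS Fg => i Ai; apply.
exact: (clusters_limit bA Ax eg gab).
Qed.

Section UltraPairs.
Context {I : Type} (F : set_system I) {FU : UltraFilter F}.

Lemma cvg_act (f : I -> Z) (x : Z) (g : G) :
  f @ F --> x -> (fun i => phi g (f i)) @ F --> phi g x.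
Proof. by move=> /fun_cvgP fx; apply/fun_cvgP => V /nbhs_act/fx. Qed.

Lemma nbhs_pair_cvg (f f' : I -> Z) (x x' : Z) (E : set (Z * Z)) :
  f @ F --> x -> f' @ F --> x' -> nbhs (x, x') E -> F [set i | E (f i, f' i)].
Proof.
move=> /fun_cvgP fx /fun_cvgP fx' [[U U'] [xU xU'] UUE].
by apply: filterS (filterI (fx _ xU) (fx' _ xU')) => i [Ui Ui']; apply: UUE.
Qed.

Lemma closed_pair_cvg (f f' : I -> Z) (x x' : Z) (E : set (Z * Z)) :
  closed E -> f @ F --> x -> f' @ F --> x' -> F [set i | E (f i, f' i)] ->
  E (x, x').
Proof.
move=> cE fx fx' FE; apply: cE => U /(nbhs_pair_cvg fx fx') FU'.
by have [i [Ei Ui]] := filter_ex (filterI FE FU'); exists (f i, f' i).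
Qed.

Lemma collapses_stabilizer (g : I -> G) (p a b : Z) : nonconical p ->
  F [set i | stabilizer phi p (g i)] -> escapes F g -> collapses F g a b ->
  a = p.
Proof.
move=> pP Fp eg gab; apply: (ultra_cvg_unique FU hZ (pP _ _ _ _ _ FU eg gab)).
apply: (ultra_near_eq_cvg (f := fun=> p)); last exact: cvg_cst.
by apply: filterS Fp => i /= ->.
Qed.

End UltraPairs.

(* If K1 (g p, g y), then the inverse of g lies on the line from p to y, and
   [shadow y g] is the side of p at that point of the line; the pair is first
   when no point of the line is strictly nearer to p. *)
Definition shadow (y : Z) (g : G) : set Z := [set z | D (phi g z, phi g y)].

Definition first_pair (p y : Z) (g : G) : Prop :=
  K1 (phi g p, phi g y) /\
  forall h, K1 (phi h p, phi h y) -> shadow y h `<=` shadow y g ->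
    shadow y g `<=` shadow y h.

(* Otherwise there are distinct points of the line whose shadows decrease. As p is
   not conical, they tend to y, hence these shadows exhaust Z \ {y}, and the first
   of them shows that y is isolated. *)
Lemma first_pair_ex (p y : Z) : nonconical p -> p <> y ->
  exists g, first_pair p y g.
Proof.
move=> pP py; apply: contrapT => nfirst.
have /choice[f fP] g : exists h, K1 (phi g p, phi g y) ->
    [/\ K1 (phi h p, phi h y), shadow y h `<=` shadow y g &
      ~ shadow y g `<=` shadow y h].
  have [gK|] := pselect (K1 (phi g p, phi g y)); last by exists 1.
  apply: contrapT => nh; apply: nfirst; exists g; split=> // h hK hg.
  by apply: contrapT => ngh; apply: nh; exists h.
have [g0 /KK1/nbhs_singleton g0K] := K_cover py.
pose u n := iter n f g0.
have uK n : K1 (phi (u n) p, phi (u n) y).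
  by elim: n => [//|n IH]; have [] := fP _ IH.
have umono m n : (m <= n)%N -> shadow y (u n) `<=` shadow y (u m).
  move=> /subnKC <-; elim: (n - m)%N => [|k IH]; first by rewrite addn0.
  by rewrite addnS; apply: subset_trans IH; have [] := fP _ (uK (m + k)%N).
have unlt m n : (m < n)%N -> u m <> u n.
  move=> mn E; have [_ _ nsub] := fP _ (uK m); apply: nsub.
  by apply: subset_trans (umono m.+1 n mn); rewrite -E.
have uinj m n : u m = u n -> m = n.
  by case: (ltngtP m n) => // [/unlt//|/unlt nm /esym].
have [F [FU _ nF]] := nonprincipal_ultrafilter infinite_nat.
have eu : escapes F u.
  apply: escapesP => x Fx; have [m mx] := filter_ex Fx.
  apply: (nF [set m]) => //; apply: filterS Fx => n /= nx; apply: uinj.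
  by rewrite nx mx.
have [a [b uab]] := ultra_collapses cvP eu.
have up := pP _ _ _ _ _ FU eu uab.
have [c uc] := ultra_cvg FU (fun n => phi (u n) y) cZ.
have acK : K1 (a, c).
  by apply: (closed_pair_cvg (@closedK1) up uc); apply: filterS filterT => n _.
have yb : y = b.
  apply: contrapT => yb; apply: (@K1_neq a); rewrite {2}(_ : a = c) //.
  exact: (ultra_cvg_unique FU hZ (collapses_cvg_cst uab yb)).
have all0 z : z <> y -> shadow y (u 0%N) z.
  move=> zy; have zb : z <> b by rewrite -yb.
  have uza : (fun n => phi (u n) z) @ F --> a by apply: collapses_cvg_cst uab zb.
  have [n un] := filter_ex (nbhs_pair_cvg uza uc (K1D acK)).
  exact: (umono 0%N n).
have [C yC sC] := D_diag (phi (u 0%N) y).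
have [z Cz zy] := not_isolated (nbhs_act yC).
by apply: (sC _ _ Cz (nbhs_singleton yC)); apply: all0.
Qed.

Definition first_positions (p : Z) : set Z :=
  [set q | exists y g, [/\ p <> y, first_pair p y g & q = phi g p]].

(* Seen as a point of the line from x to w x, the inverse of h is much nearer to
   x than 1, since everything away from q is squeezed. If q is not conical, h is
   obtained from the line joining x to q; if it is, from a family for which it is
   conical. *)
Lemma repelled_pair (F : set_system Z) {FU : UltraFilter F} (w : Z -> Z)
    (q w0 : Z) (U : set Z) :
  id @ F --> q -> w @ F --> w0 -> (forall x, ~ F [set x]) -> w0 <> q ->
  nbhs q U -> exists2 C, small C & F [set x | exists2 h,
    K1 (phi h x, phi h (w x)) & squeezes C U h].
Proof.
move=> Fq ww0 nF w0q qU.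
have [qP|qC] := pselect (nonconical q).
- have /choice[e eP] x : exists h, x <> q -> K (phi h x, phi h q).
    have [->|/K_cover[h hK]] := pselect (x = q); first by exists 1.
    by exists h.
  have Fe : F [set x | K (phi (e x) x, phi (e x) q)].
    by apply: filterS (ultraC (nF q)) => x; apply: eP.
  have ee : escapes F e.
    apply: escapesP => g Fg; apply: (@K_neq (phi g q)).
    have gx : (fun x => phi g x) @ F --> phi g q.
      exact: (@cvg_act _ F id).
    have gq : (fun=> phi g q) @ F --> phi g q by apply: cvg_cst.
    apply: (closed_pair_cvg (@closedK) gx gq).
    by apply: filterS (filterI Fe Fg) => x [/= + <-].
  have [a [b eab]] := ultra_collapses cvP ee.
  have [c ec] := ultra_cvg FU (fun x => phi (e x) x) cZ.
  have qb : q = b.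
    apply: contrapT => qb; apply: (@K_neq a).
    by apply: (closed_pair_cvg (@closedK) (collapses_cvg eab Fq qb)
      (collapses_cvg_cst eab qb)).
  have eq := qP _ _ _ _ _ FU ee eab.
  have caK : K (c, a) by apply: (closed_pair_cvg (@closedK) ec eq).
  have [C aC sC] := D_diag a; exists C => //.
  have ew : (fun x => phi (e x) (w x)) @ F --> a.
    by apply: collapses_cvg eab ww0 _; rewrite -qb.
  rewrite {}qb in qU.
  apply: filterS (filterI (nbhs_pair_cvg ec ew (KK1 caK)) (eab _ _ aC qU)).
  by move=> x [eK eCU]; exists (e x).
- have [I [E [g [a [b [EU eg gab nga]]]]]] :
      exists I (E : set_system I) (g : I -> G) a b,
      [/\ UltraFilter E, escapes E g, collapses E g a b &
      ~ (fun i => phi (g i) q) @ E --> a].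
    apply: contrapT => n; apply: qC => I E g a b EU eg gab.
    by apply: contrapT => nga; apply: n; exists I, E, g, a, b.
  have qb : q = b.
    by apply: contrapT => qb; apply/nga/(collapses_cvg_cst gab qb).
  rewrite -{b}qb in gab.
  have [c gc] := ultra_cvg EU (fun i => phi (g i) q) cZ.
  have [|h hK] := @K_cover c a; first by move=> ca; apply: nga; rewrite -ca.
  have [C aC sC] := D_diag (phi h a); exists C => //.
  have hgw : (fun i => phi (g i) w0) @ E --> a by apply: collapses_cvg_cst gab w0q.
  have hE : nbhs (c, a) [set z | K1° (phi h z.1, phi h z.2)].
    have [[V V'] /= [cV aV'] VVK] := nbhs_interior (KK1 hK).
    exists ([set z | V (phi h z)], [set z | V' (phi h z)]).
      by split; apply: nbhs_act.
    by move=> [z z'] [/= Vz Vz']; apply: VVK.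
  have hg : collapses E (fun i => h * g i) (phi h a) q by exact: collapses_mull.
  have [i [/= iK iCU]] :=
    filter_ex (filterI (nbhs_pair_cvg gc hgw hE) (hg _ _ aC qU)).
  rewrite -!actM in iK.
  have kx : (fun x => phi (h * g i) x) @ F --> phi (h * g i) q.
    exact: (@cvg_act _ F id).
  have kw : (fun x => phi (h * g i) (w x)) @ F --> phi (h * g i) w0.
    exact: cvg_act.
  by apply: filterS (nbhs_pair_cvg kx kw iK) => x xK; exists (h * g i).
Qed.

(** Otherwise distinct positions accumulate at some [q], and [repelled_pair] yields [h] for which
    the shadow of [h * g] is strictly inside that of [g], against minimality. *)
Lemma finite_first_positions (p : Z) : finite_set (first_positions p).
Proof.
apply: contrapT => /nonprincipal_ultrafilter[F [FU FQ nF]].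
have /choice[yg ygP] q : exists yg : Z * G, first_positions p q ->
    [/\ p <> yg.1, first_pair p yg.1 yg.2 & q = phi yg.2 p].
  have [[y [g qP]]|nq] := pselect (first_positions p q); first by exists (y, g).
  by exists (p, 1) => /nq.
pose w q := phi (yg q).2 (yg q).1.
have [q Fq] := ultra_cvg FU id cZ.
have [w0 ww0] := ultra_cvg FU w cZ.
have FK : F [set x | K1 (x, w x)].
  by apply: filterS FQ => x /ygP[_ [+ _] xE]; rewrite -xE.
have qwK : K1 (q, w0) by apply: (closed_pair_cvg (@closedK1) Fq ww0 FK).
have w0q : w0 <> q by move=> wq; rewrite wq in qwK; apply: K1_neq qwK.
have [[V N] /= [qV wN] VND] := K1D qwK.
have [N' [U [wN' qU N'U]]] := separation w0q.
(* The preimage of [v0] under [g] will lie in the shadow of [g] but not in that of [h * g]. *)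
have [v0 [Vv0 Uv0] v0q] := not_isolated (filterI qV qU).
have [X [Y [v0X qY XY]]] := separation v0q.
have nF1 x : ~ F [set x] by apply: nF.
have [C sC FC] := repelled_pair Fq ww0 nF1 w0q
  (filterI (filterI qV qU) qY).
move/fun_cvgP: (ww0) => ww0P.
have [x [[[Qx Nx] N'x] [h hK hC]]] := filter_ex (filterI (filterI (filterI FQ
  (ww0P _ wN)) (ww0P _ wN')) FC).
have [py [gK gmin] xE] := ygP _ Qx.
set y := (yg x).1 in py gK gmin xE; set g := (yg x).2 in gK gmin xE.
have wxE : w x = phi g y by [].
have DU z : D (phi h z, phi h (w x)) -> (V `&` U `&` Y) z.
  move=> Dz; apply: contrapT => nz; apply: (sC _ _ (hC _ nz) _ Dz).
  by apply: hC => -[[_ Uw] _]; apply: (N'U (w x)).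
have [] : ~ shadow y g `<=` shadow y (h * g).
  move=> gsub; have : shadow y (h * g) (phi g^-1 v0).
    apply: gsub; rewrite /shadow /= actVK -wxE.
    by apply: (VND (v0, w x)).
  rewrite /shadow /= !actM actVK -wxE => /DU[_ Yv0].
  by apply: (XY v0) => //; apply: nbhs_singleton.
apply: gmin; first by rewrite !actM -xE -wxE.
move=> z; rewrite /shadow /= !actM -wxE => /DU[[Vz _] _].
by apply: (VND (phi g z, w x)).
Qed.

(** Escaping elements of the stabilizer have [p] as both attracting and repelling point, so they
    move compact sets off themselves. For cocompactness, two elements taking [p] to the same first
    position differ by an element of the stabilizer, and there are finitely many positions. *)
Lemma nonconical_bounded_parabolic (p : Z) :
  nonconical p -> bounded_parabolic phi p.
Proof.
move=> pP; split.
  move=> L cL Lp; apply: contrapT => /nonprincipal_ultrafilter[F [FU FS nF]].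
  have eF : escapes F id by move=> B fB; apply: nF.
  have [a [b ab]] := ultra_collapses cvP eF.
  have ap : a = p.
    apply: (collapses_stabilizer pP _ eF ab).
    by apply: filterS FS => g [gp _].
  have bp : b = p.
    apply: (collapses_stabilizer pP _ (escapesV eF) (collapsesV ab)).
    by apply: filterS FS => g [gp _]; rewrite /stabilizer /= -{1}gp actK.
  rewrite {}ap {}bp in ab.
  have pL : nbhs p (~` L).
    apply: open_nbhs_nbhs; split; last by move=> Lpp; exact: Lp Lpp _.
    apply: closed_openC; exact: (compact_closed hZ cL).
  have [g [[_ [_ [[z Lz <-] Lgz]]] gL]] :=
    filter_ex (filterI FS (ab _ _ pL pL)).
  by apply: (gL z).
have /choice[r rP] q : exists g, first_positions p q -> phi g p = q.
  have [[y [g [_ _ ->]]]|nq] := pselect (first_positions p q); first by exists g.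
  by exists 1 => /nq.
exists (\bigcup_(q in first_positions p) [set z | K1 (q, phi (r q) z)]).
split.
- apply: subclosed_compact cZ _ => //.
  apply: closed_bigcup; first exact: finite_first_positions.
  move=> q Qq z clz; apply: closedK1 => U [[V W] /= [qV zW] VWU].
  have [x [Kx Wx]] := clz _ (nbhs_act zW).
  exists (q, phi (r q) x); split=> //; apply: VWU; split=> //=.
  exact: nbhs_singleton.
- move=> z [q Qq /=] Kq zp; rewrite zp rP // in Kq.
  exact: K1_neq Kq.
- move=> y yp; have py := nesym yp; have [g gfirst] := first_pair_ex pP py.
  have Qg : first_positions p (phi g p) by exists y, g.
  exists ((r (phi g p))^-1 * g).
    by apply: (act_inj (g := r (phi g p))); rewrite actM actVK rP.
  by exists (phi g p) => //=; rewrite actM actVK; case: gfirst.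
Qed.

Lemma collapses_eq {I : Type} (F : set_system I) {FU : UltraFilter F}
    (g k : I -> G) (a b : Z) :
  F [set i | g i = k i] -> collapses F g a b -> collapses F k a b.
Proof.
move=> gk gab U V aU bV.
by apply: filterS (filterI gk (gab _ _ aU bV)) => i [/= <-].
Qed.

(* Let g in A tend to x, and z be a point away from the limit of g^-1 x; choose h
   in the stabilizer such that h g z lies in a compact fundamental domain. If h g
   tended to x, then, x being nonconical, (h g)^-1 x = g^-1 x would tend to z.
   On the other hand, if almost all elements of the stabilizer are outside A,
   [collapses_inside] applied to h and g shows that h g tends to x. *)
Lemma infinite_stabilizer (A : set G) (x : Z) : nonconical x ->
  boundary_finite A -> clusters_at A x -> infinite_set (stabilizer phi x `&` A).
Proof.
move=> xP bA /clusters_atP[F [y [FU FA eF xy]]] fin.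
have [q gq] := ultra_cvg FU (fun g => phi g^-1 x) cZ.
have [z [zq _]] := avoid_two q q.
have [U [V [zU qV UV]]] := separation zq.
have [_ [L [cL Lx Lcov]]] := nonconical_bounded_parabolic xP.
have Fz : F [set g | phi g z <> x].
  move/fun_cvgP/(_ _ qV) : (gq); apply: filterS => g Vg gz.
  by apply: (UV z (nbhs_singleton zU)); rewrite -(actK g z) gz.
have /choice[h hP] g : exists h, phi g z <> x ->
    stabilizer phi x h /\ L (phi h (phi g z)).
  have [gz|/Lcov[h hx hL]] := pselect (phi g z = x); first by exists 1.
  by exists h.
have hx : F [set g | stabilizer phi x (h g)] by apply: filterS Fz => g /hP[].
have hVx : F [set g | stabilizer phi x (h g)^-1].
  by apply: filterS hx => g /= gx; rewrite /stabilizer /= -{1}gx actK.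
have hL : F [set g | L (phi (h g * g) z)].
  by apply: filterS Fz => g /hP[_ hL]; rewrite /= actM.
have closedL : closed L by apply: compact_closed hZ cL.
have hV_escapes : escapes F (fun g => (h g)^-1) -> F [set g | ~ A (h g)^-1].
  move=> ehV; apply: filterS (filterI hVx (ultraC (ehV _ fin))) => g [gx ngA] Ag.
  exact: ngA.
(* If [h g * g] is constantly [k0], the inverse of [h g] escapes and lies outside [A], while its
   product with [k0] is [g], in [A]: this contradicts the finite boundary. *)
have [[k0 Fk]|ek] := constant_or_escapes (fun g => h g * g).
  have hE : F [set g | (h g)^-1 = g * k0^-1].
    by apply: filterS Fk => g /= <-; rewrite invgM mulVKg.
  have ehV : escapes F (fun g => (h g)^-1).
    have ek0 : escapes F (fun g => g * k0^-1).
      exact: (@escapes_mulr _ F _ id).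
    move=> B fB FB; apply: (ek0 _ fB).
    by apply: filterS (filterI FB hE) => g [/= + <-].
  apply: (ehV _ (bA k0)).
  apply: filterS (filterI (hV_escapes ehV) (filterI hE FA)) => g [/= nAg [E Ag]].
  by split=> //; rewrite E mulgVK.
have [c [d kcd]] := ultra_collapses cvP ek.
have cx : c <> x.
  move=> cx; rewrite {}cx in kcd.
  have dz : z = d.
    apply: contrapT => zd; apply: (Lx x) => //; apply: closedL => W xW.
    have /fun_cvgP/(_ _ xW) FW : (fun g => phi (h g * g) z) @ F --> x.
      exact: collapses_cvg_cst kcd zd.
    by have [g [Lg Wg]] := filter_ex (filterI hL FW); exists (phi (h g * g) z).
  have kz : (fun g => phi (h g * g)^-1 x) @ F --> z.
    by rewrite dz; apply: (xP _ _ _ _ _ FU (escapesV ek) (collapsesV kcd)).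
  apply: zq; apply: (ultra_cvg_unique FU hZ kz).
  apply: ultra_near_eq_cvg gq; apply: filterS hVx => g /= gx.
  by rewrite invgM actM gx.
have [[h0 Fh]|eh] := constant_or_escapes h.
  apply: cx.
  have hxy : collapses F (fun g => h0 * g) (phi h0 x) y.
    exact: (collapses_mull h0 xy).
  have kxy : collapses F (fun g => h g * g) (phi h0 x) y.
    by apply: collapses_eq hxy; apply: filterS Fh => g /= ->.
  rewrite (collapses_uniq kcd kxy).
  by have [g [/= <-]] := filter_ex (filterI Fh hx).
have [a [b hab]] := ultra_collapses cvP eh.
have ax : a = x by apply: collapses_stabilizer xP hx eh hab.
have [c' kxc] := collapses_inside bA eh hab FA (hV_escapes (escapesV eh)).
by apply: cx; rewrite -ax; apply: (collapses_uniq kcd kxc).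
Qed.

End SmallSets.

(** The pairs of base points are added to the given compact set; normality of [Z * Z] then provides
    two successive closed neighborhoods off the diagonal. *)
Lemma separated_pairs (o : option bool -> Z) : injective o ->
  cocompact_on_pairs phi -> exists K K1 D : set (Z * Z),
  [/\ closed K, closed K1, (forall p, K p -> nbhs p K1),
      (forall p, K1 p -> nbhs p D) &
  [/\ (forall z : Z,
         exists2 C, nbhs z C & forall x y, C x -> C y -> ~ D (x, y)),
      (forall x y, x <> y -> exists g, K (phi g x, phi g y)) &
      (forall i j, i <> j -> K (o i, o j))]].
Proof.
move=> oinj [K0 [cK0 K0off K0cov]].
pose off : set (Z * Z) := [set z | z.1 <> z.2].
have openoff : open off.
  rewrite openE => -[x y] /separation[U [V [xU yV UV]]]; exists (U, V) => //.
  by move=> [u v] [/= Uu Vv] uv; apply: (UV u) => //; rewrite [u]uv.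
have hausZZ := hausdorff_pair hZ hZ.
have cZZ : compact [set: Z * Z] by rewrite -setXTT; apply: compact_setX.
pose B : set (Z * Z) := \bigcup_(ij in [set ij : option bool * option bool |
  ij.1 <> ij.2]) [set (o ij.1, o ij.2)].
pose K := K0 `|` B.
have Koff : K `<=` off.
  move=> _ [/K0off//|[[i j] /= ij ->]] /= /oinj; exact: ij.
have closedK : closed K.
  apply: closedU; first exact: compact_closed.
  apply: compact_closed => //; apply: finite_compact; apply: bigcup_finite.
    exact: finite_finset.
  by move=> ij _; apply: finite_set1.
have shrink A : closed A -> A `<=` off ->
    exists A', [/\ closed A', forall p, A p -> nbhs p A' & A' `<=` off].
  move=> cA Aoff; have Anb : set_nbhs A off.
    by apply/set_nbhsP; exists off; split.
  have [A' AA' A'off] := compact_normal hausZZ cZZ cA Anb.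
  exists (closure A'); split=> //; first exact: closed_closure.
  move=> p /AA'; apply: filterS; exact: subset_closure.
have [K1 [cK1 KK1 K1off]] := shrink K closedK Koff.
have [D [cD K1D Doff]] := shrink K1 cK1 K1off.
exists K, K1, D; split=> //; split=> //.
- move=> z; have : nbhs (z, z) (~` D).
    apply: open_nbhs_nbhs; split; first exact: closed_openC.
    by move=> /Doff; apply.
  move=> [[U V] /= [zU zV] UVD]; exists (U `&` V); first exact: filterI.
  by move=> x y [Ux _] [_ Vy]; apply: (UVD (x, y)).
- by move=> x y /K0cov[g gK]; exists g; left.
- by move=> i j ij; right; exists (i, j).
Qed.


Lemma base_triple : exists o : option bool -> Z, injective o.
Proof.
have [x [y [_ _ xy]]] := twoZ; have [z [zx zy]] := avoid_two x y.
exists (fun i => if i is Some b then if b then x else y else z).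
by move=> [[]|] [[]|] //= E; congruence.
Qed.

Lemma parabolic_splits (A : set G) : convergence_property phi ->
  cocompact_on_pairs phi -> minimal_action phi -> finitely_generated G ->
  infinite_set A -> infinite_set (~` A) ->
  boundary_finite A -> boundary_finite (~` A) ->
  exists x, [/\ bounded_parabolic phi x, infinite_set (stabilizer phi x `&` A) &
    infinite_set (stabilizer phi x `&` ~` A)].
Proof.
move=> cvP ccP minP fgG iA inA bA bnA.
have [o oinj] := base_triple.
have [K [K1 [D [cK cK1 KK1 K1D [Ddiag Kcov Ko]]]]] := separated_pairs oinj ccP.
have [x [Ax nAx]] := common_cluster_point cvP minP iA inA.
have xP : nonconical x.
  exact: (clusters_nonconical KK1 K1D Ddiag Kcov oinj Ko cvP fgG bA bnA Ax nAx).
exists x; split.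
- exact: (nonconical_bounded_parabolic cK cK1 KK1 K1D Ddiag Kcov cvP xP).
- exact: (infinite_stabilizer cK cK1 KK1 K1D Ddiag Kcov oinj Ko cvP fgG xP
    bA Ax).
- exact: (infinite_stabilizer cK cK1 KK1 K1D Ddiag Kcov oinj Ko cvP fgG xP
    bnA nAx).
Qed.

End Connected.
End Collapse.

(** * Ends and almost invariant sets *)

Section EndsOfSubgroup.
Variables (G : groupType) (H : set G).

Lemma mem_translate (A : set G) h x : [set y * h | y in A] x <-> A (x * h^-1).
Proof.
split=> [[y Ay <-]|Ax]; first by rewrite mulgK.
by exists (x * h^-1) => //; rewrite mulgVK.
Qed.

Hypothesis gH : is_subgroup H.

Lemma almost_invariantI (A B : set G) : almost_invariant H A ->
  almost_invariant H B -> almost_invariant H (A `&` B).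
Proof.
move=> [AH fA] [BH fB]; split=> [x [/AH]//|h Hh].
apply: (@sub_finite_set _ _ ((A `+` [set x * h | x in A]) `|`
                             (B `+` [set x * h | x in B]))).
  move=> x [[[Ax Bx] /mem_translate n]|[/mem_translate[Ax Bx] n]].
    have [Ah|nA] := pselect (A (x * h^-1)); last first.
      by left; left; split=> // /mem_translate.
    by right; left; split=> // /mem_translate Bh; apply: n.
  have [A1|nA] := pselect (A x); last first.
    by left; right; split=> //; apply/mem_translate.
  by right; right; split=> [|B1]; [apply/mem_translate|apply: n].
by rewrite finite_setU; split; [apply: fA|apply: fB].
Qed.

Lemma almost_invariantD (A : set G) : almost_invariant H A ->
  almost_invariant H (H `\` A).
Proof.
move=> [AH fA]; split=> [x []//|h Hh].
have [_ HM HV] := gH.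
apply: sub_finite_set (fA h Hh) => x.
move=> [[[Hx nAx] /mem_translate n]|[/mem_translate[Hx nAx] n]].
  right; split=> //; apply/mem_translate; apply: contrapT => nA; apply: n.
  by split=> //; apply: HM => //; apply: HV.
left; split=> [|/mem_translate//]; apply: contrapT => nA; apply: n; split=> //.
by rewrite -(mulgVK h x); apply: HM.
Qed.

(** Restrict a nonprincipal ultrafilter on [A] to the almost invariant sets. *)
Lemma end_containing (A : set G) : almost_invariant H A -> infinite_set A ->
  exists2 E, Ends H E & E A.
Proof.
move=> aA /nonprincipal_ultrafilter[F [FU FA nF]].
exists [set B | almost_invariant H B /\ F B]; last by split.
split.
- by move=> B [].
- move=> B C [aB FB] [aC FC]; split; [exact: almost_invariantI|exact: filterI].
- by move=> B C [_ FB] aC BC; split=> //; apply: filterS FB.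
- move=> B aB; have [FB|FnB] := in_ultra_setVsetC B FU; [by left|right].
  split; first exact: almost_invariantD.
  by apply: filterS (filterI FA FnB) => x [/(aA.1)].
- by move=> B [_ FB] fB; apply: (nF _ fB FB).
Qed.

Lemma more_than_one_ends (A : set G) : almost_invariant H A ->
  infinite_set A -> infinite_set (H `\` A) -> more_than_one (Ends H).
Proof.
move=> aA iA iB; have [E EE EA] := end_containing aA iA.
have [E' EE' E'B] := end_containing (almost_invariantD aA) iB.
exists E, E'; split=> // EE'E; rewrite -{}EE'E in E'B.
case: EE => _ EI _ _ Einf; apply: (Einf _ (EI _ _ EA E'B)).
by rewrite setDE setIA setIAC setICr set0I.
Qed.

(** A set in one end and not in the other has its complement in the other, and members of ends are
    infinite. *)
Lemma ends_almost_invariant : more_than_one (Ends H) ->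
  exists A, [/\ almost_invariant H A, infinite_set A & infinite_set (H `\` A)].
Proof.
move=> [E [E' [EE EE' nE]]].
have separate D D' : is_end H D -> is_end H D' -> ~ D `<=` D' ->
    exists A, [/\ almost_invariant H A, infinite_set A & infinite_set (H `\` A)].
  move=> [Dai _ _ _ Dinf] [_ _ _ D'o D'inf] /existsNP[A /not_implyP[DA nD'A]].
  exists A; split; [exact: Dai|exact: Dinf|apply: D'inf].
  by case: (D'o A (Dai _ DA)).
have [EsE'|nEE'] := pselect (E `<=` E'); last exact: separate nEE'.
by apply: separate EE' EE _ => E'E; apply: nE; apply/seteqP.
Qed.

End EndsOfSubgroup.

(** * Transfer from the stabilizer to a representative in [P] *)

Lemma stabilizer_subgroup (G : groupType) (Z : topologicalType)
    (phi : topological_action G Z) (p : Z) : is_subgroup (stabilizer phi p).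
Proof.
split=> [|g h gp hp|g gp]; rewrite /stabilizer /= ?act1 ?actM ?hp ?gp //.
by rewrite -{1}gp actK.
Qed.

Theorem corollary3p27 (G : groupType) (P : set (set G))
    (Z : topologicalType) :
  finitely_generated G ->
  relatively_hyperbolic P ->
  more_than_one (Ends [set: G]) ->
  is_bowditch_boundary P Z -> connected [set: Z] ->
  exists2 H : set G, P H & more_than_one (Ends H).
Proof.
move=> fgG _ /ends_almost_invariant[A [[_ aA] iA inA]].
move=> [hZ cZ [phi [[cvP moreZ ccP] [Pstab Prep]] minP]] coZ.
rewrite minP in moreZ; rewrite setTD in inA.
have bA : boundary_finite A.
  move=> s; apply: sub_finite_set (aA s^-1 Logic.I) => x [nAx Axs]; right.
  by split=> //; apply/mem_translate; rewrite invgK.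
have bnA : boundary_finite (~` A).
  move=> s; apply: sub_finite_set (aA s^-1 Logic.I) => x [/contrapT Ax nAxs]; left.
  by split=> // /mem_translate; rewrite invgK.
have [x [xP iHA iHnA]] :=
  parabolic_splits hZ cZ coZ moreZ cvP ccP minP fgG iA inA bA bnA.
have [H [[PH [g gH]] _]] := Prep _ xP; exists H => //.
have [p _ Hp] := Pstab _ PH.
have sH : is_subgroup H by rewrite Hp; apply: stabilizer_subgroup.
have infinite_conj B : infinite_set (stabilizer phi x `&` B) ->
    infinite_set [set h | H h /\ B (g * h * g^-1)].
  move=> iB /(finite_image (fun h => g * h * g^-1)) fB; apply: iB.
  apply: sub_finite_set fB => y []; rewrite -gH => -[h Hh <-] Bh.
  by exists h.
(* [A] is pulled back by the conjugation taking [H] to the stabilizer of [x]; it turns right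
   translation by [h] into right translation by [g * h * g^-1]. *)
apply: (more_than_one_ends sH (A := [set h | H h /\ A (g * h * g^-1)])).
- split=> [h []//|h Hh].
  pose c := g * h * g^-1.
  have cE y : g * (y * h^-1) * g^-1 = g * y * g^-1 * c^-1.
    by rewrite /c !invgM invgK !mulgA mulgVK.
  have := aA c Logic.I => /(finite_image (fun y => g^-1 * y * g)).
  apply: sub_finite_set => y yS; exists (g * y * g^-1); last first.
    by rewrite !mulgA mulVg mul1g mulgVK.
  have Hyh : H (y * h^-1) <-> H y.
    have [_ HM HV] := sH; split=> [Hyh|Hy]; last by apply: HM => //; apply: HV.
    by rewrite -(mulgVK h y); apply: HM.
  case: yS => -[].
    move=> [Hy Ay] n; left; split=> // /mem_translate Ayc; apply: n.
    by apply/mem_translate; split; [apply/Hyh|rewrite cE].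
  move=> /mem_translate[/Hyh Hy Ayh] n; right; split.
    by apply/mem_translate; rewrite -cE.
  by move=> Ay; apply: n.
- exact: infinite_conj.
- apply: sub_infinite_set (infinite_conj _ iHnA) => h [Hh nAh].
  by split=> // -[].
Qed.
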